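(* Consider the linear regression model $X_k=\theta\phi_k+\varepsilon_k$, $k=1,\dots,n$, where $\theta\in\mathbb{R}$ is an unknown parameter, $(\phi_k)_{k=1,\dots,n}$ is a sequence of independent random variables, $(\varepsilon_k)_{k=1,\dots,n}$ is a sequence of martingale differences with respect to its natural filtration, and $(\phi_k)$ and $(\varepsilon_k)$ are independent. Let $\theta_n=\sum_{k=1}^n\phi_kX_k\big/\sum_{k=1}^n\phi_k^2$. Let $p>2$. Assume that $\mathbf{E}[\varepsilon_i^2\mid\sigma\{\varepsilon_j,j\le i-1\}]=\sigma^2$ a.s. for a positive constant $\sigma$ and all $i\in[1,n]$, and that $\mathbf{E}[|\varepsilon_i|^p]\le A$ for a constant $A$ and all $i\in[1,n]$. Then there is a constant $C_p$ depending only on $A,\sigma$ and $p$ such that for all $x\in\mathbb{R}$, $$\Bigg|\mathbf{P}\Big((\theta_n-\theta)\sqrt{\textstyle\sum_{k=1}^n\phi_k^2}\le x\sigma\Big)-\Phi(x)\Bigg|\le C_p\Bigg(\sum_{i=1}^n\mathbf{E}\Bigg[\bigg|\frac{\phi_i}{\sqrt{\sum_{k=1}^n\phi_k^2}}\bigg|^p\Bigg]\Bigg)^{1/(1+p)}\frac{1}{1+|x|^p}.$$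
   Context: $\Phi(x)=\frac{1}{\sqrt{2\pi}}\int_{-\infty}^xe^{-t^2/2}\,dt$ is the standard normal distribution function. It is implicitly assumed that $\sum_{k=1}^n\phi_k^2>0$ almost surely, so that $\theta_n$ is well defined. *)

(* Defs.v *)
From HB Require Import structures.
From mathcomp Require Import all_boot all_order all_algebra.
From mathcomp Require Import all_classical all_reals all_analysis.
Set Implicit Arguments. Unset Strict Implicit. Unset Printing Implicit Defensive.
Import Order.TTheory GRing.Theory Num.Theory.
Import numFieldNormedType.Exports.
Local Open Scope classical_set_scope.
Local Open Scope ring_scope.

(* Indices are 0-based: k = 0, ..., n-1 stands for the paper's k = 1, ..., n. *)

Section Defs.
Context {d : measure_display} {T : measurableType d} {R : realType}.

Definition sigma_of (f : T -> R) : set (set T) :=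
  [set A | exists B : set R, measurable B /\ A = f @^-1` B].

Definition sigma_fam (F : nat -> T -> R) (m : nat) : set (set T) :=
  <<s [set A | exists (j : nat) (B : set R),
          (j < m)%N /\ measurable B /\ A = F j @^-1` B] >>.

(* mutual independence of F 0, ..., F (n-1): product rule on all events
   A_i in sigma(F i) (taking A_i = setT gives every subfamily) *)
Definition mutually_indep (P : probability T R) (n : nat) (F : nat -> T -> R) :=
  forall A : 'I_n -> set T, (forall i : 'I_n, sigma_of (F i) (A i)) ->
    P [set w | forall i : 'I_n, A i w] = (\prod_(i < n) P (A i))%E.

Definition indep_sigma (P : probability T R) (F G : set (set T)) :=
  forall A B, F A -> G B -> P (A `&` B) = (P A * P B)%E.

(* (eps_k)_{k<n} is a martingale difference sequence w.r.t. its natural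
   filtration: eps_i integrable and E[eps_i | sigma(eps_j, j < i)] = 0 a.s.,
   written via the defining property of conditional expectation *)
Definition martingale_diff (P : probability T R) (n : nat) (eps : nat -> T -> R) :=
  forall i, (i < n)%N ->
    P.-integrable setT (fun w => (eps i w)%:E) /\
    forall A, sigma_fam eps i A -> (\int[P]_(w in A) (eps i w)%:E = 0)%E.

(* E[eps_i^2 | sigma(eps_j, j < i)] = s^2 a.s., via the defining property of
   conditional expectation *)
Definition cond_var_const (P : probability T R) (n : nat) (eps : nat -> T -> R) (s : R) :=
  forall i, (i < n)%N ->
    P.-integrable setT (fun w => (eps i w ^+ 2)%:E) /\
    forall A, sigma_fam eps i A ->
      (\int[P]_(w in A) (eps i w ^+ 2)%:E = (s ^+ 2)%:E * P A)%E.

Definition obs (theta : R) (phi eps : nat -> T -> R) (k : nat) (w : T) : R :=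
  theta * phi k w + eps k w.

Definition sumsq (n : nat) (phi : nat -> T -> R) (w : T) : R :=
  \sum_(k < n) phi k w ^+ 2.

Definition theta_hat (n : nat) (phi X : nat -> T -> R) (w : T) : R :=
  (\sum_(k < n) phi k w * X k w) / sumsq n phi w.

End Defs.

Definition Phi {R : realType} (x : R) : R :=
  (Num.sqrt (2 * pi))^-1 *
  (\int[@lebesgue_measure R]_(t in `]-oo, x]) expR (- (t ^+ 2) / 2)).

(* Main.v *)
(** Given the regressors, the normalized error is a sum S = a_1 e_1 + ... + a_n e_n
    of martingale differences with deterministic weights, sum a_i^2 = 1, and
    deterministic conditional variances; the theorem follows from a nonuniform
    Berry-Esseen bound for S by Fubini and a concavity argument.

    With r_k = a_{k+1}^2 + ... + a_n^2, the function Phi((x - s) / sqrt(theta + r))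
    solves the heat equation backwards in r, so Lindeberg's telescoping of
    E Phi((x - S_k) / sqrt(theta + r_k)) in k has vanishing first and second order
    terms.  At step k, jumps below y_k are paid for by the third derivative, which
    is localized at distance sqrt(theta + r_k) from x, and larger jumps by the p-th
    moment; y_k = c w (w / sqrt(theta + r_k))^(2/(p-2)), with w^2 = theta, makes
    both errors summable.  The localized term is controlled by
    E exp(-(x - S_k)^2 / 2 tau) = O(sqrt tau), which is proved by induction on k from
    the same telescoping, a Gaussian bump being dominated by a difference of two
    values of Phi.  Taking w = L^(1/(1+p)) (1 + |x|)^(p^2), L = sum |a_i|^p, and c a
    negative power of 1 + |x| yields the polynomial decay as long as w <= 1; beyond
    that range a Fuk-Nagaev tail bound suffices. *)

Require Import Defs.
From HB Require Import structures.
From mathcomp Require Import all_boot all_order all_algebra.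
From mathcomp Require Import all_classical all_reals all_analysis.
From mathcomp Require Import measurable_realfun ring lra.
Set Implicit Arguments. Unset Strict Implicit. Unset Printing Implicit Defensive.
Import Order.TTheory GRing.Theory Num.Theory.
Import numFieldNormedType.Exports.
Local Open Scope classical_set_scope.
Local Open Scope ring_scope.

(** * The normal distribution function *)

(** Localization is what makes the rate reachable. Put g = 1/(p-2), q^2 = theta + r_{k+1}, and
    measure jumps in units of q. A bare third-derivative bound leaves small-jump errors c
    (w/q)^(1+2g) a_k^2/q^2, whose sum is only O(c); the factor O(q) gained from concentration turns
    it into O(c w). The exponent of the truncation level is the one for which y^(2-p) (|a_k|/q)^p
    does not depend on q, so large jumps cost c^(2-p) w^(-p) L in total, and w = L^(1/(1+p))
    balances this against the smoothing error w. The concentration bound occurs in its own proof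
    with a coefficient proportional to c, so c is fixed to make that coefficient one half. For the
    decay in X = 1 + |x|, write del = L^(1/(1+p)) and take w = del X^m, c = X^(-(m+p)). Then c w =
    del X^(-p), while c^(2-p) w^(-p) L = del X^(p(p-2)-2m) is no larger once m >= p(p-1)/2; m = p^2
    is a convenient choice. If w exceeds 1, then X^(-(p^2+p)) <= del X^(-p), so a tail term of order
    p^2+p is affordable. *)

Definition phi0 {R : realType} (t : R) : R :=
  (Num.sqrt (2 * pi))^-1 * expR (- (t ^+ 2) / 2).

Section gaussian.
Context {R : realType}.
Implicit Types (x v h t : R).

Lemma phi0_normal_pdf x : phi0 x = normal_pdf 0 1 x.
Proof.
rewrite normal_pdfE ?oner_neq0// /normal_peak /normal_fun /phi0.
by rewrite expr1n mul1r subr0 mulr_natl.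
Qed.

Lemma integrable_phi0 (D : set R) : measurable D ->
  lebesgue_measure.-integrable D (EFin \o (phi0 : R -> R)).
Proof.
move=> mD; apply: (integrableS measurableT) => //.
rewrite (_ : EFin \o _ = fun x => (normal_pdf 0 1 x)%:E).
  exact: integrable_normal_pdf.
by apply/funext => x /=; rewrite phi0_normal_pdf.
Qed.

Lemma sqrt2pi_gt0 : 0 < Num.sqrt (2 * pi) :> R.
Proof. by rewrite sqrtr_gt0 mulr_gt0 ?pi_gt0. Qed.

Lemma sqrt2pi_inv_le1 : (Num.sqrt (2 * pi))^-1 <= 1 :> R.
Proof.
rewrite invf_le1 ?sqrt2pi_gt0// -[leLHS]sqrtr1 ler_wsqrtr//.
by have := pi_ge2 R; lra.
Qed.

Lemma Phi_phi0 x : Phi x = \int[lebesgue_measure]_(t in `]-oo, x]) phi0 t.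
Proof.
rewrite /Phi -RintegralZl//.
rewrite (_ : EFin \o _ = fun t => ((Num.sqrt (2 * pi))%:E * (phi0 t)%:E)%E).
  by apply: integrableZl => //; exact: integrable_phi0.
apply/funext => t /=; rewrite -EFinM /phi0 mulrA divff ?mul1r//.
by rewrite gt_eqF ?sqrt2pi_gt0.
Qed.

Lemma phi0_ge0 x : 0 <= phi0 x.
Proof. by rewrite mulr_ge0 ?expR_ge0// invr_ge0 ltW ?sqrt2pi_gt0. Qed.

Lemma phi0_le x : phi0 x <= expR (- (x ^+ 2) / 2).
Proof. by rewrite ler_piMl ?expR_ge0 ?sqrt2pi_inv_le1. Qed.

Lemma is_derive_Phi x : is_derive x 1 (Phi : R -> R) (phi0 x).
Proof.
have [] := @continuous_FTC1 R phi0 -oo%O x (x + 1) _ _ _ _.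
- by rewrite ltrDl.
- exact: integrable_phi0.
- by rewrite ltNyr.
- rewrite (_ : phi0 = normal_pdf 0 1); last first.
    by apply/funext => t; exact: phi0_normal_pdf.
  by apply: continuous_normal_pdf; rewrite oner_neq0.
- rewrite -(_ : Phi = fun y => \int[lebesgue_measure]_(t in `]-oo, y]) phi0 t).
    by move=> dP PE; rewrite derive1E in PE; rewrite -PE; exact/derivableP.
  by apply/funext => t; exact: Phi_phi0.
Qed.

Lemma Phi_normal_prob x : (Phi x)%:E = normal_prob 0 1 `]-oo, x].
Proof.
rewrite Phi_phi0 /Rintegral fineK; last first.
  exact/integrable_fin_num/integrable_phi0.
by apply: eq_integral => t _; rewrite phi0_normal_pdf.
Qed.

Lemma Phi_ge0 x : 0 <= Phi x.
Proof. by rewrite -lee_fin Phi_normal_prob. Qed.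

Lemma Phi_le1 x : Phi x <= 1.
Proof. by rewrite -lee_fin Phi_normal_prob probability_le1. Qed.

Lemma is_derive_gauss x :
  is_derive x 1 (fun t : R => expR (- t ^+ 2 / 2)) (- x * expR (- x ^+ 2 / 2)).
Proof.
apply: (@is_derive_eq).
rewrite /GRing.scale/=; by field.
Qed.

Lemma is_derive_phi0 x : is_derive x 1 (phi0 : R -> R) (- x * phi0 x).
Proof.
have h := is_derive_gauss x.
apply: (@is_derive_eq).
by rewrite /GRing.scale/= /phi0 mulrCA.
Qed.

(** The identity is made a random variable under the standard normal law, so that the limits of
    [Phi] at infinity become those of a distribution function. *)
Let idR : measurableTypeR R -> R := idfun.

#[local] HB.instance Definition _ :=
  @isMeasurableFun.Build _ _ _ _ idR (@measurable_id _ _ setT).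

Let cdf_id :
  cdf (idR : {RV (normal_prob 0 1 : probability _ R) >-> R}) = EFin \o Phi.
Proof. by apply/funext => x; rewrite /= Phi_normal_prob. Qed.

Lemma cvg_Phi_y : Phi x @[x --> +oo] --> (1 : R).
Proof.
by have := cvg_cdfy1 (idR : {RV (normal_prob 0 1 : probability _ R) >-> R});
  rewrite cdf_id => /fine_cvgP[].
Qed.

Lemma cvg_Phi_Ny : Phi x @[x --> -oo] --> (0 : R).
Proof.
by have := cvg_cdfNy0 (idR : {RV (normal_prob 0 1 : probability _ R) >-> R});
  rewrite cdf_id => /fine_cvgP[].
Qed.

(** No order is assumed between [a] and [b], and the intermediate point is a convex combination: the
    increments to which this is applied have unknown sign. *)
Lemma mean_value (f df : R -> R) a b : (forall x, is_derive x 1 f (df x)) ->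
  exists2 t, 0 <= t <= 1 & f b - f a = df (a + t * (b - a)) * (b - a).
Proof.
move=> fdf.
have fc : continuous f.
  by move=> x; apply/differentiable_continuous/derivable1_diffP; apply: ex_derive.
wlog ab : a b / a < b => [wl|].
  have [|ba|->] := ltgtP a b; first exact: wl.
    have [t /andP[t0 t1] e] := wl _ _ ba.
    exists (1 - t); first by apply/andP; split; lra.
    rewrite -(opprK (f b - f a)) opprB e -mulrN opprB; congr (df _ * _); ring.
  by exists 0; rewrite ?lexx ?ler01// !subrr mulr0.
have [] := @MVT R f df a b ab (fun x _ => fdf x).
  exact: continuous_subspaceT.
move=> c /[!in_itv]/= /andP[ac cb] ->.
have ba0 : 0 < b - a by rewrite subr_gt0.
exists ((c - a) / (b - a)).
  by rewrite divr_ge0 ?(ltW ba0) ?subr_ge0 ?(ltW ac)//= ler_pdivrMr// mul1r; lra.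
by rewrite divfK ?gt_eqF// [a + _]addrC subrK.
Qed.

(** Two nested mean values; this loses the factor 1/2 of the sharp remainder, which is harmless
    here. *)
Lemma taylor1 (f f1 f2 : R -> R) v h :
  (forall x, is_derive x 1 f (f1 x)) -> (forall x, is_derive x 1 f1 (f2 x)) ->
  exists2 t, 0 <= t <= 1 &
    `|f (v + h) - f v - h * f1 v| <= h ^+ 2 * `|f2 (v + t * h)|.
Proof.
move=> d1 d2.
have [s /andP[s0 s1] e] := mean_value v (v + h) d1.
have [t /andP[t0 t1] e'] := mean_value v (v + s * h) d2.
have E : v + h - v = h by ring.
have E' : v + s * h - v = s * h by ring.
rewrite E in e; rewrite E' in e'.
exists (t * s).
  by rewrite mulr_ge0//= (le_trans (ler_piMl _ t1)).
have -> : f (v + h) - f v - h * f1 v = s * (h ^+ 2 * f2 (v + t * s * h)).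
  by rewrite e mulrC -mulrBr e' mulrA; ring.
rewrite normrM normrM (ger0_norm s0) normrX real_normK ?num_real//.
by rewrite ler_piMl// mulr_ge0// sqr_ge0.
Qed.

Lemma taylor2 (f f1 f2 f3 : R -> R) v h :
  (forall x, is_derive x 1 f (f1 x)) -> (forall x, is_derive x 1 f1 (f2 x)) ->
  (forall x, is_derive x 1 f2 (f3 x)) ->
  exists2 t, 0 <= t <= 1 &
    `|f (v + h) - f v - h * f1 v - h ^+ 2 / 2 * f2 v|
      <= `|h| ^+ 3 * `|f3 (v + t * h)|.
Proof.
move=> d1 d2 d3.
(* The second-order remainder as a function of the increment: its derivative is the first-order
   remainder of [f1], so one mean value reduces the claim to [taylor1]. *)
pose r s := f (v + s) - f v - s * f1 v - s ^+ 2 / 2 * f2 v.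
have dr (s : R) : is_derive s 1 r (f1 (v + s) - f1 v - s * f2 v).
  have := d1 (v + s) => d1'.
  have ds : is_derive s 1 (fun s => f (v + s)) (f1 (v + s)).
    rewrite (_ : (fun _ => _) = f \o shift v); last first.
      by apply/funext => y /=; rewrite addrC.
    rewrite -[f1 _]mulr1; apply: is_derive1_comp; last exact: is_derive_shift.
    by rewrite /= addrC.
  apply: is_derive_eq.
  rewrite /GRing.scale /=; by field.
have [s /andP[s0 s1]] := mean_value 0 h dr.
rewrite subr0 add0r {2}/r addr0 subrr mul0r expr0n mul0r mul0r !subr0 => e.
have [t /andP[t0 t1] e'] := taylor1 v (s * h) d2 d3.
exists (t * s).
  by rewrite mulr_ge0//= (le_trans (ler_piMl _ t1)).
have : (s * h) ^+ 2 * `|f3 (v + t * (s * h))| <= `|h| ^+ 2 * `|f3 (v + t * (s * h))|.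
  rewrite ler_wpM2r// exprMn real_normK ?num_real// ler_piMl ?sqr_ge0//.
  by rewrite expr_le1.
move=> /(le_trans e') h1.
by rewrite -/(r h) e normrM -[t * s * h]mulrA exprS -mulrA mulrC ler_wpM2l.
Qed.

End gaussian.

(** * Tails, windows and local expansions of [Phi] *)

Section gaussian2.
Context {R : realType}.
Implicit Types (x v h t : R).

Lemma Phi_le : {homo (Phi : R -> R) : u v / u <= v}.
Proof.
move=> u v uv; have [t _ e] := mean_value u v is_derive_Phi.
by rewrite -subr_ge0 e mulr_ge0 ?phi0_ge0// subr_ge0.
Qed.

(** Only the half of the window on the side of the origin is kept: there [s ^+ 2 <= v ^+ 2 + 1], so
    the density is at least that at [v] times exp(-1/2). *)
Lemma gauss_window_ge v :
  (Num.sqrt (2 * pi))^-1 * expR (- 2^-1) * expR (- v ^+ 2 / 2)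
    <= Phi (v + 1) - Phi (v - 1).
Proof.
have key s : s ^+ 2 <= v ^+ 2 + 1 ->
    (Num.sqrt (2 * pi))^-1 * expR (- 2^-1) * expR (- v ^+ 2 / 2) <= phi0 s.
  move=> sv; rewrite -mulrA -expRD ler_wpM2l ?invr_ge0 ?(ltW sqrt2pi_gt0)//.
  rewrite ler_expR; lra.
have [v0|v0] := leP 0 v.
  have [t /andP[t0 t1] e] := mean_value (v - 1) v is_derive_Phi.
  apply: (@le_trans _ _ (Phi v - Phi (v - 1))); last first.
    by rewrite lerD2r Phi_le// lerDl.
  rewrite e; have -> : v - (v - 1) = 1 by ring.
  rewrite !mulr1; apply: key; nra.
have [t /andP[t0 t1] e] := mean_value v (v + 1) is_derive_Phi.
apply: (@le_trans _ _ (Phi (v + 1) - Phi v)); last first.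
  by rewrite lerD2l lerN2 Phi_le// gerBl.
rewrite e; have -> : v + 1 - v = 1 by ring.
rewrite !mulr1; apply: key; nra.
Qed.

(** Up to 1/2 the right-hand side already exceeds 1. Beyond 1/2 the left side minus the right side
    is nondecreasing, because [2 * s >= 1] dominates the normalizing factor, and it tends to 0,
    hence it is nonpositive. *)
Lemma Phi_tail_y v : 0 <= v -> 1 - Phi v <= 2 * expR (- v ^+ 2 / 2).
Proof.
move=> v0; have [v2|v2] := leP v (1 / 2).
  have := expR_ge1Dx (- v ^+ 2 / 2); have := Phi_ge0 v; nra.
pose f s : R := 1 - Phi s - 2 * expR (- s ^+ 2 / 2).
pose df s : R := 2 * s * expR (- s ^+ 2 / 2) - phi0 s.
have dfE (s : R) : is_derive s 1 f (df s).
  have h1 := is_derive_Phi s; have h2 := is_derive_gauss s.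
  apply: is_derive_eq; rewrite /GRing.scale /df/=; ring.
rewrite -subr_le0 -/(f v) leNgt; apply/negP => fv0.
have : f x @[x --> +oo] --> (0 : R).
  rewrite -[X in _ --> X](_ : 1 - 1 - 2 * 0 = 0); last by ring.
  apply: cvgB; first by apply: cvgB; [exact: cvg_cst|exact: cvg_Phi_y].
  apply: cvgMr.
  rewrite (_ : (fun _ => _) = (fun x : R => gauss_fun (x / Num.sqrt 2))).
    apply: (cvg_comp (fun x : R => x / Num.sqrt 2) gauss_fun); last exact: cvg_gauss_fun.
    by apply: gt0_cvgMly => //; rewrite invr_gt0 sqrtr_gt0.
  apply/funext => s; rewrite /gauss_fun expr_div_n sqr_sqrtr//.
  by rewrite mulNr.
move/cvgrPdist_lt => /(_ _ fv0) [M [_ /(_ (Num.max v (M + 1)))]].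
rewrite lt_max ltrDl ltr01 orbT => /(_ isT).
rewrite sub0r normrN; set u := Num.max v _.
have vu : v <= u by rewrite le_max lexx.
have [t /andP[t0 t1] e] := mean_value v u dfE.
move=> fu; have : f u - f v < 0.
  by rewrite subr_lt0 (le_lt_trans _ fu)// ler_norm.
rewrite e ltNge => /negP; apply; rewrite mulr_ge0 ?subr_ge0//.
apply: le_trans (phi0_le _) _.
by rewrite ler_peMl ?expR_ge0//; nra.
Qed.

Lemma Phi_opp v : Phi (- v) = 1 - Phi v.
Proof.
pose f s : R := Phi s + Phi (- s).
have dfE (s : R) : is_derive s 1 f 0.
  have h1 := is_derive_Phi s; have h2 := is_derive_Phi (- s).
  have : is_derive s 1 (fun s => Phi (- s)) (phi0 (- s) * - 1).
    exact: is_derive1_comp.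
  move=> h3; apply: is_derive_eq; rewrite /phi0 sqrrN; ring.
have fc s : f s = f v.
  have [t _] := mean_value v s dfE.
  by rewrite mul0r => /eqP; rewrite subr_eq0 => /eqP.
have : f x @[x --> +oo] --> (1 : R).
  rewrite -[X in _ --> X]addr0; apply: cvgD; first exact: cvg_Phi_y.
  by have := @cvg_Phi_Ny R; rewrite cvgNy_compNP.
rewrite (_ : f = fun=> f v); last by apply/funext => s.
move=> f1; have fv : f v = 1.
  by rewrite -(cvg_lim (@Rhausdorff R) f1); apply/esym/cvg_lim => //; exact: cvg_cst.
by move: fv; rewrite /f; lra.
Qed.

Lemma Phi_tail_Ny v : 0 <= v -> Phi (- v) <= 2 * expR (- v ^+ 2 / 2).
Proof. by rewrite Phi_opp; exact: Phi_tail_y. Qed.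

Lemma gauss_indicator v :
  Phi v - 2 * expR (- v ^+ 2 / 2) <= (if 0 <= v then 1 else 0)
    <= Phi v + 2 * expR (- v ^+ 2 / 2).
Proof.
have e0 := expR_ge0 (- v ^+ 2 / 2); have p0 := Phi_ge0 v; have p1 := Phi_le1 v.
case: ifPn => [v0|].
  by have := Phi_tail_y v0; lra.
rewrite -ltNge => /ltW v0.
have := @Phi_tail_Ny (- v); rewrite oppr_ge0 opprK sqrrN => /(_ v0); lra.
Qed.

(** The exponential dominates the square of 1 + v^2/16, whose leading term is v^4/256; this is the
    origin of 256. The cube is bounded by 1 + v^4. *)
Lemma norm_cube_le v : `|v| ^+ 3 <= 256 * expR (v ^+ 2 / 8).
Proof.
have h := expR_ge1Dx (v ^+ 2 / 16).
have -> : v ^+ 2 / 8 = v ^+ 2 / 16 + v ^+ 2 / 16 by field.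
rewrite expRD; set e := expR _ in h *.
have : (1 + v ^+ 2 / 16) ^+ 2 <= e * e.
  by rewrite -expr2 lerXn2r ?nnegrE ?(le_trans _ h)//; have := sqr_ge0 v; lra.
rewrite -(real_normK (num_real v)); set u := `|v|; have u0 : 0 <= u := normr_ge0 v.
move=> h2.
have : u ^+ 3 <= 1 + u ^+ 4.
  rewrite exprS [u ^+ 4]exprS.
  have : 0 <= u ^+ 3 by rewrite exprn_ge0.
  have [u1|u1] := leP u 1; last nra.
  have : u ^+ 2 <= 1 by rewrite expr_le1.
  have := sqr_ge0 u; nra.
have : 0 <= u ^+ 2 by exact: sqr_ge0.
lra.
Qed.

Lemma norm_le_expR v : `|v| <= 256 * expR (v ^+ 2 / 8).
Proof.
have := norm_cube_le v; have := expR_ge1Dx (v ^+ 2 / 8).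
rewrite -(real_normK (num_real v)); set u := `|v|; have u0 : 0 <= u := normr_ge0 v.
set e := expR _; move=> h1 h2.
have [u1|u1] := leP u 1; first nra.
apply: le_trans h2; rewrite !exprS expr0 mulr1; nra.
Qed.

Lemma norm_phi0_le v : `|v * phi0 v| <= 256 * expR (- v ^+ 2 / 8).
Proof.
rewrite normrM (ger0_norm (phi0_ge0 v)).
apply: (@le_trans _ _ (256 * expR (v ^+ 2 / 8) * expR (- v ^+ 2 / 2))).
  by apply: ler_pM; rewrite ?phi0_ge0 ?norm_le_expR ?phi0_le.
rewrite -mulrA -expRD ler_wpM2l// ler_expR; have := sqr_ge0 v; lra.
Qed.

Lemma norm_phi0_le1 v : `|v * phi0 v| <= 1.
Proof.
rewrite normrM (ger0_norm (phi0_ge0 v)).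
apply: (@le_trans _ _ (expR (v ^+ 2 / 2) * expR (- v ^+ 2 / 2))).
  apply: ler_pM; rewrite ?phi0_ge0 ?phi0_le//.
  apply: le_trans (expR_ge1Dx _).
  rewrite -[in leRHS]real_normK ?num_real//; set u := `|v|; nra.
by rewrite -expRD mulNr subrr expR0.
Qed.

(** This estimate sets the Gaussian rate 1/8 used everywhere below: a shift by at most 1 leaves
    [v ^+ 2 / 2 - 1] of the square, and absorbing the polynomial factor of the third derivative
    halves the exponent again. *)
Lemma Phi_taylor_small v h : `|h| <= 1 ->
  `|Phi (v + h) - Phi v - h * phi0 v + h ^+ 2 / 2 * (v * phi0 v)|
    <= 4 * expR (1 / 4) * `|h| ^+ 3 * expR (- v ^+ 2 / 8).
Proof.
move=> h1.
have d3 (x : R) : is_derive x 1 (fun x => - x * phi0 x) ((x ^+ 2 - 1) * phi0 x).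
  have h0 := is_derive_phi0 x.
  apply: is_derive_eq; rewrite /GRing.scale/=; ring.
have [t /andP[t0 t1]] := taylor2 v h is_derive_Phi is_derive_phi0 d3.
rewrite mulNr mulrN opprK => /le_trans; apply.
set u := v + t * h.
have hu : v ^+ 2 / 2 - 1 <= u ^+ 2.
  have : (t * h) ^+ 2 <= 1.
    have h2 : h ^+ 2 <= 1 by rewrite -(real_normK (num_real h)) expr_le1.
    rewrite exprMn; have := sqr_ge0 h; have : t ^+ 2 <= 1 by rewrite expr_le1.
    nra.
  have := sqr_ge0 (v + 2 * (t * h)); rewrite /u; set z := t * h; nra.
rewrite -[leRHS]mulrA [leRHS]mulrCA ler_wpM2l ?exprn_ge0//.
rewrite normrM (ger0_norm (phi0_ge0 u)).
apply: (@le_trans _ _ (4 * expR (u ^+ 2 / 4) * expR (- u ^+ 2 / 2))).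
  apply: ler_pM; rewrite ?phi0_ge0 ?phi0_le//.
  have := expR_ge1Dx (u ^+ 2 / 4); have := sqr_ge0 u => u0 e1.
  by rewrite ler_norml; apply/andP; split; lra.
rewrite -!mulrA -!expRD ler_wpM2l// ler_expR; lra.
Qed.

Lemma Phi_taylor_large v h :
  `|Phi (v + h) - Phi v - h * phi0 v + h ^+ 2 / 2 * (v * phi0 v)| <= 2 * h ^+ 2.
Proof.
have [t _ T] := taylor1 v h is_derive_Phi is_derive_phi0.
apply: (le_trans (ler_normD _ _)).
have -> : 2 * h ^+ 2 = h ^+ 2 * 1 + h ^+ 2 * 1 by ring.
apply: lerD.
  by apply: (le_trans T); rewrite ler_wpM2l ?sqr_ge0// mulNr normrN norm_phi0_le1.
rewrite normrM; apply: ler_pM; rewrite ?norm_phi0_le1//.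
by rewrite ger0_norm; have := sqr_ge0 h; lra.
Qed.

(** Enlarging a unit variance by [a ^+ 2] rescales the argument by [b]. The expansion is in the
    scale, around 1: the slope is [v * phi0 v] and b - 1 = - a^2/2 + O(a^4). As [- v * phi0 v] is
    the second derivative of [Phi], this is the heat equation in integrated form, matching the
    [h ^+ 2 / 2] term of the expansion in space. *)
Lemma Phi_scale v a b : 0 <= a <= 1 -> 0 <= b -> b ^+ 2 * (1 + a ^+ 2) = 1 ->
  `|Phi (b * v) - Phi v + a ^+ 2 / 2 * (v * phi0 v)|
     <= 512 * a ^+ 4 * expR (- v ^+ 2 / 8).
Proof.
move=> /andP[a0 a1] b0 bE.
have d1 (s : R) : is_derive s 1 (fun s => Phi (s * v)) (v * phi0 (s * v)).
  have h := is_derive_Phi (s * v).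
  rewrite mulrC; apply: is_derive1_comp.
  by apply: is_derive_eq; rewrite /GRing.scale/=; ring.
have d2 (s : R) : is_derive s 1 (fun s => v * phi0 (s * v))
    (- s * v ^+ 3 * phi0 (s * v)).
  have h := is_derive_phi0 (s * v).
  have h2 : is_derive s 1 (fun s => phi0 (s * v)) (- (s * v) * phi0 (s * v) * v).
    apply: is_derive1_comp.
    by apply: is_derive_eq; rewrite /GRing.scale/=; ring.
  apply: is_derive_eq; rewrite /GRing.scale/=; ring.
have [t /andP[t0 t1]] := taylor1 1 (b - 1) d1 d2.
rewrite !mul1r (addrC 1) subrK.
set s := 1 + t * (b - 1).
have b1 : b <= 1 by have := sqr_ge0 a; nra.
have a2 : a ^+ 2 <= 1 by rewrite expr_le1.
have b2 : 1 / 2 <= b ^+ 2 by have := sqr_ge0 a; nra.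
have bs : b <= s by rewrite /s; nra.
have s1 : s <= 1 by rewrite /s; nra.
have hb1 : 1 - b <= a ^+ 2.
  have : (1 - b) * (1 + b) = b ^+ 2 * a ^+ 2 by lra.
  have := sqr_ge0 a; nra.
have hb2 : `|b - 1 + a ^+ 2 / 2| <= a ^+ 4.
  have e : (1 - b) * (1 + b) = b ^+ 2 * a ^+ 2 by lra.
  have -> : a ^+ 4 = a ^+ 2 * a ^+ 2 by ring.
  set z := a ^+ 2 in e hb1 a2 bE *; have z0 : 0 <= z by exact: sqr_ge0.
  (* Multiplication by [1 + b] trades b^2 - 1 for - b^2 z; the first order cancels and leaves the
     factor [1 - b], itself at most [z]. *)
  have e2 : (b - 1 + z / 2) * (2 * (1 + b)) = z * (2 * b + 1) * (1 - b) by nra.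
  rewrite ger0_norm; last first.
    by rewrite -(pmulr_lge0 _ (_ : 0 < 2 * (1 + b))) ?e2; nra.
  have : (b - 1 + z / 2) * (2 * (1 + b)) <= z * z * (2 * (1 + b)).
    rewrite e2; have : z * (1 - b) <= z * z by nra.
    nra.
  by rewrite ler_pM2r//; lra.
move=> T; set E := expR _.
have -> : Phi (b * v) - Phi v + a ^+ 2 / 2 * (v * phi0 v) =
  (Phi (b * v) - Phi v - (b - 1) * (v * phi0 v)) +
  (b - 1 + a ^+ 2 / 2) * (v * phi0 v) by ring.
apply: (le_trans (ler_normD _ _)).
have -> : 512 * a ^+ 4 * E = a ^+ 4 * (256 * E) + a ^+ 4 * (256 * E) by ring.
apply: lerD; last first.
  by rewrite normrM ler_pM// norm_phi0_le.
apply: (le_trans T); apply: ler_pM; rewrite ?sqr_ge0//.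
  have -> : a ^+ 4 = a ^+ 2 ^+ 2 by ring.
  by rewrite -sqrrN lerXn2r ?nnegrE ?sqr_ge0//; lra.
rewrite normrM (ger0_norm (phi0_ge0 _)) normrM normrN normrX.
apply: (@le_trans _ _ (256 * expR (v ^+ 2 / 8) * expR (- (s * v) ^+ 2 / 2))).
  apply: ler_pM; rewrite ?phi0_ge0 ?phi0_le ?mulr_ge0 ?exprn_ge0//.
  apply: le_trans (norm_cube_le v); rewrite ler_piMl ?exprn_ge0//.
  by rewrite ger0_norm; lra.
rewrite -mulrA -expRD ler_wpM2l// ler_expR exprMn.
have : b ^+ 2 <= s ^+ 2 by rewrite lerXn2r ?nnegrE//; lra.
have := sqr_ge0 v; nra.
Qed.

End gaussian2.

(** * A single Lindeberg exchange and the cost of Gaussian smoothing *)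

Section gaussian3.
Context {R : realType}.
Implicit Types (x v h t w : R).

Lemma sqr_le_powR (p y z : R) : 2 < p -> 0 < y -> y <= z ->
  z ^+ 2 <= y `^ (2 - p) * z `^ p.
Proof.
move=> p2 y0 yz; have z0 : 0 < z by apply: lt_le_trans yz.
have -> : p = 2 + (p - 2) by ring.
rewrite (@powRD _ z) ?(gt_eqF z0) ?implybT// powR_mulrn ?(ltW z0)// mulrCA ler_peMr ?sqr_ge0//.
have -> : 2 - (2 + (p - 2)) = - (p - 2) by ring.
rewrite powRN -[leLHS](@mulVf _ (y `^ (p - 2))) ?gt_eqF ?powR_gt0//.
rewrite ler_wpM2l ?invr_ge0 ?powR_ge0// ge0_ler_powR ?nnegrE ?(ltW y0) ?(ltW z0)//.
by lra.
Qed.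

Lemma expR_quarter_le2 : expR (1 / 4) <= 2 :> R.
Proof.
rewrite -[1 / 4]opprK expRN -[leRHS]invrK lef_pV2 ?posrE ?expR_gt0 ?invr_gt0//.
by apply: le_trans (expR_ge1Dx _); lra.
Qed.

(* Locked, so that conversion never unfolds the numeral. *)
Definition lindC : R := locked 1024.

Lemma lindC_gt0 : 0 < lindC.
Proof. by rewrite /lindC -lock ltr0n. Qed.

(** One exchange, in units where the variance still to come is 1: a jump [h] against a Gaussian of
    variance [a ^+ 2]. The subtracted terms are those linear in [h] and in [h ^+ 2 - a ^+ 2], which
    have conditional mean zero. Whichever of [|h|] and [a] is below [y] leaves a localized
    remainder; above [y], a quadratic remainder is converted into a p-th power by [sqr_le_powR]. *)
Lemma Phi_lindeberg p v h a b y : 2 < p -> 0 <= a <= 1 -> 0 <= b ->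
  b ^+ 2 * (1 + a ^+ 2) = 1 -> 0 < y <= 1 ->
  `|Phi (v + h) - Phi (b * v) - h * phi0 v + (h ^+ 2 - a ^+ 2) / 2 * (v * phi0 v)|
    <= lindC * (y * (h ^+ 2 + a ^+ 2) * expR (- v ^+ 2 / 8)
              + y `^ (2 - p) * (`|h| `^ p + a `^ p)).
Proof.
move=> p2 a01 b0 bE /andP[y0 y1]; have /andP[a0 a1] := a01.
set Z := y * _ * _ + _.
have Z0 : 0 <= Z.
  apply: addr_ge0; last by rewrite mulr_ge0 ?addr_ge0 ?powR_ge0.
  by rewrite mulr_ge0 ?expR_ge0// mulr_ge0 ?addr_ge0 ?sqr_ge0// ltW.
(* The argument gives 512; the larger [lindC] lets [Phi_dilation] share the constant. *)
apply: (@le_trans _ _ (512 * Z)); last first.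
  by apply: ler_wpM2r => //; rewrite /lindC -lock ler_nat.
rewrite {Z0}/Z.
have S := Phi_scale v a01 b0 bE.
have -> : Phi (v + h) - Phi (b * v) - h * phi0 v + (h ^+ 2 - a ^+ 2) / 2 * (v * phi0 v)
  = (Phi (v + h) - Phi v - h * phi0 v + h ^+ 2 / 2 * (v * phi0 v))
    - (Phi (b * v) - Phi v + a ^+ 2 / 2 * (v * phi0 v)) by field.
apply: (le_trans (ler_normB _ _)).
set E := expR _ in S *; have E0 : 0 <= E by exact: expR_ge0.
have E1 : E <= 1 by rewrite expR_le1; have := sqr_ge0 v; lra.
have -> : 512 * (y * (h ^+ 2 + a ^+ 2) * E + y `^ (2 - p) * (`|h| `^ p + a `^ p))
  = (512 * (y * h ^+ 2 * E + y `^ (2 - p) * `|h| `^ p))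
  + (512 * (y * a ^+ 2 * E + y `^ (2 - p) * a `^ p)) by ring.
apply: lerD.
  have q0 : 0 <= y `^ (2 - p) * `|h| `^ p by rewrite mulr_ge0 ?powR_ge0.
  have [hy|hy] := leP `|h| y.
    apply: (le_trans (Phi_taylor_small _ _)); first exact: le_trans y1.
    rewrite -/E exprS -(real_normK (num_real h)).
    set u := `|h| in hy *; have u0 : 0 <= u := normr_ge0 h.
    have := expR_quarter_le2; set e := expR (1 / 4) => e2.
    have e0 : 0 <= e by exact: expR_ge0.
    have : 4 * e * (u * u ^+ 2) * E <= 512 * (y * u ^+ 2 * E).
      have -> : 4 * e * (u * u ^+ 2) * E = (4 * e) * (u * (u ^+ 2 * E)) by ring.
      rewrite -(mulrA y); apply: ler_pM; rewrite ?mulr_ge0 ?sqr_ge0//; first lra.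
      by rewrite ler_wpM2r// mulr_ge0 ?sqr_ge0.
    by set q := _ * _ `^ p in q0 *; lra.
  apply: (le_trans (Phi_taylor_large _ _)).
  have := sqr_le_powR p2 y0 (ltW hy); rewrite (real_normK (num_real h)).
  have : 0 <= y * h ^+ 2 * E by rewrite mulr_ge0// mulr_ge0 ?sqr_ge0 ?(ltW y0).
  by set q := _ * _ `^ p in q0 *; set q' := _ * _ * E; have := sqr_ge0 h; lra.
rewrite -[X in _ <= X]mulrA in S; apply: (le_trans S); apply: ler_wpM2l; first exact: ler0n.
have -> : a ^+ 4 = a ^+ 2 * a ^+ 2 by ring.
have a2 : a ^+ 2 <= 1 by rewrite expr_le1.
have a20 := sqr_ge0 a.
have q0 : 0 <= y `^ (2 - p) * a `^ p by rewrite mulr_ge0 ?powR_ge0.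
have q'0 : 0 <= y * a ^+ 2 * E by rewrite mulr_ge0// mulr_ge0 ?(ltW y0).
have [ay|ay] := leP a y.
  apply: (@le_trans _ _ (y * a ^+ 2 * E)); last by rewrite lerDl.
  by rewrite ler_wpM2r// ler_wpM2r//; nra.
apply: (@le_trans _ _ (y `^ (2 - p) * a `^ p)); last by rewrite lerDr.
apply: le_trans (sqr_le_powR p2 y0 (ltW ay)).
rewrite -mulrA ler_piMr// mulr_ile1//.
Qed.

(** Since (1 + |x|)^q <= exp(q |x|), it remains to complete a square: q |x| <= x^2/8 + 2 q^2. *)
Lemma gauss_decay q x : 0 <= q ->
  expR (- x ^+ 2 / 8) <= expR (2 * q ^+ 2) * (1 + `|x|) `^ (- q).
Proof.
move=> q0; have X0 : 0 < 1 + `|x| by rewrite ltr_pwDl.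
rewrite powRN ler_pdivlMr ?powR_gt0//.
have : (1 + `|x|) `^ q <= expR (`|x| * q).
  rewrite expRM ge0_ler_powR ?nnegrE ?expR_ge0 ?(ltW X0)//.
  exact: expR_ge1Dx.
move=> /(ler_wpM2l (expR_ge0 (- x ^+ 2 / 8))) /le_trans; apply.
rewrite -expRD ler_expR -(real_normK (num_real x)).
have := sqr_ge0 (`|x| - 4 * q); lra.
Qed.

Lemma Phi_window w b x : 0 <= w <= 1 -> 0 <= b -> b ^+ 2 * (1 + w ^+ 2) = 1 ->
  Phi (b * (x + w)) - Phi (b * (x - w)) <= 4 * w * expR (- x ^+ 2 / 8).
Proof.
move=> /andP[w0 w1] b0 bE.
have w2 : w ^+ 2 <= 1 by rewrite expr_le1.
have b1 : b <= 1 by have := sqr_ge0 w; nra.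
have b2 : 1 / 2 <= b ^+ 2 by have := sqr_ge0 w; nra.
have [t /andP[t0 t1] ->] := mean_value (b * (x - w)) (b * (x + w)) is_derive_Phi.
have -> : b * (x + w) - b * (x - w) = b * (2 * w) by ring.
have -> : b * (x - w) + t * (b * (2 * w)) = b * (x + (2 * t - 1) * w) by ring.
set s := (2 * t - 1) * w; have s2 : s ^+ 2 <= 1.
  have -> : s ^+ 2 = (2 * t - 1) ^+ 2 * w ^+ 2 by rewrite /s; ring.
  by rewrite mulr_ile1 ?sqr_ge0//; nra.
have ph : phi0 (b * (x + s)) <= 2 * expR (- x ^+ 2 / 8).
  apply: (le_trans (phi0_le _)).
  apply: le_trans (ler_wpM2r (expR_ge0 _) expR_quarter_le2).
  rewrite -expRD ler_expR exprMn.
  have h1 := sqr_ge0 (x + 2 * s).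
  have h2 : 1 / 2 * (x + s) ^+ 2 <= b ^+ 2 * (x + s) ^+ 2.
    by rewrite ler_wpM2r ?sqr_ge0.
  lra.
apply: (@le_trans _ _ (2 * expR (- x ^+ 2 / 8) * (2 * w))); last by lra.
have w20 : 0 <= 2 * w by rewrite mulr_ge0.
by apply: ler_pM => //; rewrite ?phi0_ge0 ?(mulr_ge0 b0)// ler_piMl.
Qed.

Lemma Phi_dilation w b x : 0 <= w <= 1 -> 0 <= b -> b ^+ 2 * (1 + w ^+ 2) = 1 ->
  `|Phi (b * x) - Phi x| <= lindC * w * expR (- x ^+ 2 / 8).
Proof.
move=> w01 b0 bE; have /andP[w0 w1] := w01.
have S := Phi_scale x w01 b0 bE.
have -> : Phi (b * x) - Phi x = (Phi (b * x) - Phi x + w ^+ 2 / 2 * (x * phi0 x))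
   - w ^+ 2 / 2 * (x * phi0 x) by ring.
apply: (le_trans (ler_normB _ _)).
set E := expR _ in S *; have E0 : 0 <= E by exact: expR_ge0.
have H : `|w ^+ 2 / 2 * (x * phi0 x)| <= w ^+ 2 / 2 * (256 * E).
  rewrite normrM ger0_norm ?divr_ge0 ?sqr_ge0// ler_wpM2l ?divr_ge0 ?sqr_ge0//.
  exact: norm_phi0_le.
apply: (le_trans (lerD S H)).
have w2 : w ^+ 2 <= w by nra.
have w4 : w ^+ 4 <= w.
  have -> : w ^+ 4 = w ^+ 2 * w ^+ 2 by ring.
  have := sqr_ge0 w; nra.
have : w ^+ 2 * E <= w * E by rewrite ler_wpM2r.
have : w ^+ 4 * E <= w * E by rewrite ler_wpM2r.
have : 0 <= w * E by rewrite mulr_ge0.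
rewrite /lindC -lock; lra.
Qed.

(** Twice the inverse of the constant in [gauss_window_ge]; the factor 2 is that of the error in
    [gauss_indicator], so that [Phi_sandwich] holds with exactly this constant. *)
Definition windowK : R := 2 * (Num.sqrt (2 * pi) * expR 2^-1).

Lemma windowK_gt0 : 0 < windowK.
Proof. by rewrite !mulr_gt0 ?sqrt2pi_gt0 ?expR_gt0. Qed.

Lemma gauss_le_window v :
  expR (- v ^+ 2 / 2) <= windowK / 2 * (Phi (v + 1) - Phi (v - 1)).
Proof.
have := gauss_window_ge v; rewrite expRN -invfM mulrC ler_pdivrMr; last first.
  by rewrite mulr_gt0 ?sqrt2pi_gt0 ?expR_gt0.
by rewrite /windowK => /le_trans; apply; rewrite mulrC; lra.
Qed.

(** The error of replacing an indicator by [Phi] is again expressed by values of [Phi]; its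
    expectation is therefore a difference of smoothed probabilities, to which the Lindeberg bound
    applies as well. *)
Lemma Phi_sandwich v :
  Phi v - windowK * (Phi (v + 1) - Phi (v - 1)) <= (if 0 <= v then 1 else 0)
    <= Phi v + windowK * (Phi (v + 1) - Phi (v - 1)).
Proof.
have /andP[h1 h2] := gauss_indicator v; have := gauss_le_window v; lra.
Qed.

End gaussian3.

(** * Integration against sub-sigma-algebras *)

Section sub_sigma_algebra.
Context {d : measure_display} {T : measurableType d} {R : realType}.
Variables (P : {measure set T -> \bar R}) (G : set (set T)).
Hypothesis Gm : G `<=` d.-measurable.

Lemma sub_sigma_measurable : <<s G >> `<=` d.-measurable.
Proof. exact: smallest_sub (@sigma_algebra_measurable _ T) Gm. Qed.

Lemma sub_sigma_measurable_fun d' (U : measurableType d') (f : T -> U) :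
  measurable_fun setT (f : g_sigma_algebraType G -> U) -> measurable_fun setT f.
Proof.
move=> mf _ B mB; rewrite setTI; apply: sub_sigma_measurable.
by have := mf measurableT _ mB; rewrite setTI.
Qed.

Local Open Scope ereal_scope.
Import HBNNSimple.

Lemma ge0_integral_sub_sigma (f g Y : T -> R) :
  (forall x, (0 <= f x)%R) -> measurable_fun setT f ->
  (forall x, (0 <= g x)%R) -> measurable_fun setT g ->
  (forall A, <<s G >> A ->
    \int[P]_(x in A) (f x)%:E = \int[P]_(x in A) (g x)%:E) ->
  (forall x, (0 <= Y x)%R) ->
  measurable_fun setT (Y : g_sigma_algebraType G -> R) ->
  \int[P]_x (Y x * f x)%:E = \int[P]_x (Y x * g x)%:E.
Proof.
move=> f0 mf g0 mg fg Y0 mY.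
have mEY : @measurable_fun _ _ (g_sigma_algebraType G) (\bar R) setT (EFin \o Y).
  exact/measurable_EFinP.
(* The simple functions are measurable for the generated sigma-algebra, so their level sets lie in
   [<<s G >>] and the hypothesis applies to each of them. *)
pose h := nnsfun_approx measurableT mEY.
have mh n : measurable_fun setT (h n : T -> R).
  exact/sub_sigma_measurable_fun/measurable_funP.
have lim_h (u : T -> R) : (forall x, (0 <= u x)%R) -> measurable_fun setT u ->
    \int[P]_x (Y x * u x)%:E = lim (\int[P]_x (h n x * u x)%:E @[n --> \oo]).
  move=> u0 mu.
  have YE x : (Y x * u x)%:E = lim ((h n x * u x)%:E @[n --> \oo]).
    apply/esym/cvg_lim => //; under eq_fun do rewrite EFinM; rewrite EFinM.
    apply: cvgeZr => //; apply: (cvg_nnsfun_approx measurableT mEY) => // y _.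
    by rewrite /= lee_fin.
  under eq_integral do rewrite YE.
  apply: monotone_convergence => //.
  - by move=> n; apply/measurable_EFinP; apply: measurable_funM.
  - by move=> n x _; rewrite lee_fin mulr_ge0.
  - move=> x _ a b ab; rewrite lee_fin ler_wpM2r//.
    by have /lefP := nd_nnsfun_approx measurableT mEY ab; exact.
suff key n : \int[P]_x (h n x * f x)%:E = \int[P]_x (h n x * g x)%:E.
  by rewrite !lim_h//; under eq_fun do rewrite key.
have sum_h (u : T -> R) : (forall x, (0 <= u x)%R) -> measurable_fun setT u ->
    \int[P]_x (h n x * u x)%:E =
    \sum_(y \in range (h n)) y%:E * \int[P]_(x in h n @^-1` [set y]) (u x)%:E.
  move=> u0 mu.
  have my y : measurable (h n @^-1` [set y] : set T).
    by rewrite -[X in measurable X]setTI; exact: mh.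
  transitivity (\int[P]_x \sum_(y \in range (h n))
      (y * \1_(h n @^-1` [set y]) x * u x)%:E).
    apply: eq_integral => x _.
    by rewrite {1}(fimfunE (h n)) mulr_fsuml// fsumEFin.
  rewrite ge0_integral_fsum//; last 2 first.
  - move=> y; apply/measurable_EFinP; apply: measurable_funM => //.
    apply: measurable_funM => //.
  - move=> y x _; rewrite lee_fin mulr_ge0// -lee_fin.
    exact: nnfun_muleindic_ge0.
  apply: eq_fsbigr => y; rewrite inE => -[t _ <-].
  under eq_integral do rewrite -mulrA EFinM.
  rewrite ge0_integralZl//.
  - congr (_ * _); rewrite [RHS]integral_mkcond; apply: eq_integral => x _.
    rewrite patchE indicE; case: ifPn => _; first by rewrite mul1r.
    by rewrite mul0r.
  - by apply/measurable_EFinP; apply: measurable_funM.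
  - by move=> x _; rewrite lee_fin mulr_ge0.
  - by rewrite lee_fin fun_ge0.
rewrite !sum_h//; apply: eq_fsbigr => y _; congr (_ * _).
by apply: fg; have := measurable_funP (h n) measurableT [set y]; rewrite setTI; apply.
Qed.
End sub_sigma_algebra.

(** * Integrability of bounded factors and testing of conditional identities *)

Section expectation_tools.
Context {d : measure_display} {T : measurableType d} {R : realType}.
Variable P : probability T R.
Implicit Types f g Y : T -> R.

Lemma integrable_scale (r : R) f : P.-integrable setT (EFin \o f) ->
  P.-integrable setT (fun x => (r * f x)%:E).
Proof. by move=> fi; exact: (integrableZl measurableT r fi). Qed.

Lemma integrable_add f g : P.-integrable setT (EFin \o f) ->
  P.-integrable setT (EFin \o g) -> P.-integrable setT (fun x => (f x + g x)%:E).
Proof. by move=> fi gi; exact: (integrableD measurableT fi gi). Qed.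

Lemma integrable_sub f g : P.-integrable setT (EFin \o f) ->
  P.-integrable setT (EFin \o g) -> P.-integrable setT (fun x => (f x - g x)%:E).
Proof. by move=> fi gi; exact: (integrableB measurableT fi gi). Qed.

Lemma bounded_integrable (M : R) Y : measurable_fun setT Y -> (forall x, `|Y x| <= M) ->
  P.-integrable setT (EFin \o Y).
Proof.
move=> mY YM; apply: (@le_integrable _ _ _ P setT measurableT _ (EFin \o cst M)).
- exact/measurable_EFinP.
- move=> x _; rewrite /= lee_fin (le_trans (YM x))//.
  exact: ler_norm.
- by apply: finite_measure_integrable_cst.
Qed.

Lemma bounded_mul_integrable (M : R) Y f : measurable_fun setT Y ->
  (forall x, `|Y x| <= M) -> P.-integrable setT (EFin \o f) ->
  P.-integrable setT (fun x => (Y x * f x)%:E).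
Proof.
move=> mY YM fi.
have mf : measurable_fun setT f by apply/measurable_EFinP; exact: measurable_int fi.
apply: (@le_integrable _ _ _ P setT measurableT _ (fun x => (M * `|f x|)%:E)).
- by apply/measurable_EFinP; exact: measurable_funM.
- move=> x _; rewrite /= lee_fin !normrM normr_id ler_wpM2r//.
  by rewrite (le_trans (YM x))// ler_norm.
- have -> : (fun x => (M * `|f x|)%:E) = (fun x => (M%:E * (`|f x|)%:E)%E).
    by apply/funext => x; rewrite EFinM.
  apply: integrableZl => //.
  exact: (integrable_norm fi).
Qed.

Lemma norm_Rintegral_le f g : P.-integrable setT (EFin \o f) ->
  P.-integrable setT (EFin \o g) -> (forall x, `|f x| <= g x) ->
  `|\int[P]_x f x| <= \int[P]_x g x.
Proof.
move=> fi gi fg; apply: (le_trans (le_normr_Rintegral _ _)) => //.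
apply: le_Rintegral => //.
exact: integrable_norm fi.
Qed.

Lemma Rintegral_cstP (r : R) : \int[P]_x r = r.
Proof. by rewrite Rintegral_cst// [X in fine X](_ : _ = 1%E) ?mulr1//; exact: probability_setT. Qed.

Variable G : set (set T).
Hypothesis Gm : G `<=` d.-measurable.

Lemma Rintegral_sub_sigma (M : R) f g Y : P.-integrable setT (EFin \o f) ->
  P.-integrable setT (EFin \o g) ->
  (forall A, <<s G >> A ->
    (\int[P]_(x in A) (f x)%:E = \int[P]_(x in A) (g x)%:E)%E) ->
  measurable_fun setT (Y : g_sigma_algebraType G -> R) ->
  (forall x, `|Y x| <= M) ->
  \int[P]_x (Y x * f x) = \int[P]_x (Y x * g x).
Proof.
move=> fi gi fg mY YM.
have mf : measurable_fun setT f by apply/measurable_EFinP; exact: measurable_int fi.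
have mg : measurable_fun setT g by apply/measurable_EFinP; exact: measurable_int gi.
have mYT : measurable_fun setT Y by exact: sub_sigma_measurable_fun mY.
(* A common dominating function makes [B + f] and [B + g] nonnegative, as [M] does for [Y + M]. In
   the product of the nonnegative factors all terms but the wanted one agree on both sides and
   cancel. *)
pose B x := `|f x| + `|g x|.
have Bi : P.-integrable setT (EFin \o B).
  rewrite (_ : EFin \o B = ((EFin \o (fun x => `|f x|%R)) \+ (EFin \o (fun x => `|g x|%R)))%E)//.
  by apply: integrableD => //; [exact: integrable_norm fi|exact: integrable_norm gi].
have mB : measurable_fun setT B by apply/measurable_EFinP; exact: measurable_int Bi.
have key u : P.-integrable setT (EFin \o u) -> measurable_fun setT u ->
    \int[P]_x ((Y x + M) * (B x + u x)) =
    \int[P]_x (Y x * u x) + (\int[P]_x ((Y x + M) * B x) + M * \int[P]_x u x).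
  move=> ui mu.
  have YMB : P.-integrable setT (fun x => ((Y x + M) * B x)%:E).
    apply: (@bounded_mul_integrable (M + M)) => //; first exact: measurable_funD.
    move=> x; apply: (le_trans (ler_normD _ _)); rewrite lerD// ger0_norm//.
    by rewrite (le_trans _ (YM x)).
  rewrite -RintegralZl// -RintegralD//; last exact: integrable_scale.
  rewrite -RintegralD//; last 2 first.
  - exact: bounded_mul_integrable YM ui.
  - exact/(integrable_add YMB)/integrable_scale.
  by apply: eq_Rintegral => x _; ring.
have I : \int[P]_x f x = \int[P]_x g x.
  by rewrite /Rintegral fg//; exact: (@measurableT _ (g_sigma_algebraType G)).
have : \int[P]_x ((Y x + M) * (B x + f x)) = \int[P]_x ((Y x + M) * (B x + g x)).
  rewrite /Rintegral (@ge0_integral_sub_sigma _ _ _ P G Gm _ (fun x => B x + g x))//.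
  - by move=> x; have := ler_norm (- f x); rewrite normrN /B; have := normr_ge0 (g x); lra.
  - exact: measurable_funD.
  - by move=> x; have := ler_norm (- g x); rewrite normrN /B; have := normr_ge0 (f x); lra.
  - exact: measurable_funD.
  - move=> A GA; have mA := sub_sigma_measurable Gm GA.
    have iS u : P.-integrable setT (EFin \o u) -> P.-integrable A (EFin \o u).
      by move=> ui; apply: integrableS ui.
    under eq_integral do rewrite EFinD.
    rewrite integralD_EFin// ?iS// fg// -integralD_EFin ?iS//.
  - by move=> x; have := YM x; rewrite ler_norml; lra.
  - exact: measurable_funD.
by rewrite !key// I => /addIr.
Qed.
End expectation_tools.

(** * Lindeberg telescoping *)

(** The generator alone, as required by [g_sigma_algebraType]; [sigma_fam xi k] is convertible to
    [<<s past xi k >>]. *)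
Definition past {T : Type} {R : realType} (xi : nat -> T -> R) (k : nat) :
    set (set T) :=
  [set A | exists (j : nat) (B : set R),
             (j < k)%N /\ measurable B /\ A = xi j @^-1` B].

Section det_var.
Context {d : measure_display} {T : measurableType d} {R : realType}.

(** Conditional mean and variance appear in weak form, against bounded test functions of the past.
    This is the form in which the telescoping and the exponential moments use them, and it passes
    easily to sign changes and deterministic rescalings. *)
Record det_var_mds (P : probability T R) (n : nat) (xi : nat -> T -> R)
    (a : nat -> R) (p A : R) : Prop := DetVarMds {
  dv_meas : forall k, measurable_fun setT (xi k);
  dv_int : forall k, (k < n)%N -> P.-integrable setT (EFin \o xi k);
  dv_int2 : forall k, (k < n)%N -> P.-integrable setT (fun w => (xi k w ^+ 2)%:E);
  dv_intp : forall k, (k < n)%N ->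
    P.-integrable setT (fun w => (`|xi k w| `^ p)%:E);
  dv_mean : forall k (M : R) (Y : T -> R), (k < n)%N ->
    measurable_fun setT (Y : g_sigma_algebraType (past xi k) -> R) ->
    (forall w, `|Y w| <= M) -> \int[P]_w (Y w * xi k w) = 0;
  dv_var : forall k (M : R) (Y : T -> R), (k < n)%N ->
    measurable_fun setT (Y : g_sigma_algebraType (past xi k) -> R) ->
    (forall w, `|Y w| <= M) ->
    \int[P]_w (Y w * xi k w ^+ 2) = a k ^+ 2 * \int[P]_w Y w;
  dv_mom : forall k, (k < n)%N -> \int[P]_w (`|xi k w| `^ p) <= A * `|a k| `^ p
}.

Definition psum (xi : nat -> T -> R) (k : nat) (w : T) : R :=
  \sum_(j < k) xi j w.

Lemma measurable_past (xi : nat -> T -> R) k j : (j < k)%N ->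
  measurable_fun setT (xi j : g_sigma_algebraType (past xi k) -> R).
Proof.
move=> jk _ B mB; rewrite setTI; apply: sub_sigma_algebra.
by exists j, B.
Qed.

Lemma past_measurable (xi : nat -> T -> R) k :
  (forall j, measurable_fun setT (xi j)) -> past xi k `<=` d.-measurable.
Proof.
move=> mxi _ [j [B [_ [mB ->]]]].
by rewrite -[X in measurable X]setTI; exact: mxi.
Qed.

Lemma measurable_psum_past (xi : nat -> T -> R) k :
  measurable_fun setT (psum xi k : g_sigma_algebraType (past xi k) -> R).
Proof. by apply: measurable_sum => j; exact: measurable_past. Qed.

End det_var.

Section lindeberg_step.
Context {d : measure_display} {T : measurableType d} {R : realType}.
Variables (P : probability T R) (n : nat) (xi : nat -> T -> R) (a : nat -> R).
Variables (p A : R).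
Hypotheses (p2 : 2 < p) (H : det_var_mds P n xi a p A).

Local Notation S := (psum xi).

Lemma measurable_phi0 : measurable_fun setT (phi0 : R -> R).
Proof.
rewrite (_ : phi0 = normal_pdf 0 1); first exact: measurable_normal_pdf.
by apply/funext => x; rewrite phi0_normal_pdf.
Qed.

Lemma measurable_Phi : measurable_fun setT (Phi : R -> R).
Proof. by apply: nondecreasing_measurable => //; exact: Phi_le. Qed.

Lemma measurable_psum k : measurable_fun setT (S k).
Proof. by apply: measurable_sum => j; exact: (dv_meas H). Qed.

Definition rem k := \sum_(k <= i < n) a i ^+ 2.

Lemma rem_ge0 k : 0 <= rem k.
Proof. by apply: sumr_ge0 => i _; exact: sqr_ge0. Qed.

Lemma remS k : (k < n)%N -> rem k = rem k.+1 + a k ^+ 2.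
Proof. by move=> kn; rewrite /rem big_ltn// addrC. Qed.

(** The probability that S_k plus an independent centred normal variable of variance [theta + rem k]
    is at most [x]: the increments not yet revealed are replaced by Gaussians. *)
Definition smoothed (x theta : R) k :=
  \int[P]_w Phi ((x - S k w) / Num.sqrt (theta + rem k)).

Definition window (x tau : R) k :=
  \int[P]_w expR (- (x - S k w) ^+ 2 / (2 * tau)).

Lemma lindeberg_step (x theta tau y : R) k : (k < n)%N ->
  tau = theta + rem k.+1 -> 0 < tau -> a k ^+ 2 <= tau -> 0 < y <= 1 ->
  `|smoothed x theta k.+1 - smoothed x theta k| <=
    lindC * (y * (2 * a k ^+ 2 / tau) * window x (4 * tau) k
           + y `^ (2 - p) * ((A + 1) * (`|a k| / Num.sqrt tau) `^ p)).
Proof.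
move=> kn tauE' tau0 ak y01; have /andP[y0 y1] := y01.
set q := Num.sqrt tau.
have q0 : 0 < q by rewrite sqrtr_gt0.
have q2 : q ^+ 2 = tau by rewrite sqr_sqrtr// ltW.
pose a' := `|a k| / q.
have a'2 : a' ^+ 2 = a k ^+ 2 / tau by rewrite expr_div_n real_normK ?num_real// q2.
have a'01 : 0 <= a' <= 1.
  rewrite divr_ge0 ?(ltW q0)//= -(@expr_le1 _ 2)// ?divr_ge0 ?(ltW q0)//.
  by rewrite a'2 ler_pdivrMr// mul1r.
pose q' := Num.sqrt (theta + rem k).
have tauE : theta + rem k = tau + a k ^+ 2 by rewrite tauE' (remS kn) addrA.
have q'0 : 0 < q' by rewrite sqrtr_gt0 tauE ltr_wpDr// sqr_ge0.
have q'2 : q' ^+ 2 = tau + a k ^+ 2 by rewrite sqr_sqrtr tauE// addr_ge0 ?sqr_ge0 ?(ltW tau0).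
pose b := q / q'.
have b0 : 0 <= b by rewrite divr_ge0 ?ltW.
have bE : b ^+ 2 * (1 + a' ^+ 2) = 1.
  rewrite expr_div_n q'2 q2 a'2; field.
  by rewrite gt_eqF//= gt_eqF// ltr_wpDr ?sqr_ge0.
pose v w := (x - S k w) / q.
pose h w := - xi k w / q.
(* The coefficients of [xi k] and of its square: bounded functions of the past, hence admissible in
   [dv_mean] and [dv_var]. *)
pose Y1 w := - phi0 (v w) / q.
pose Y2 w := v w * phi0 (v w) / (2 * tau).
pose Y3 w := expR (- v w ^+ 2 / 8) / tau.
have mv : measurable_fun setT (v : g_sigma_algebraType (past xi k) -> R).
  apply: measurable_funM => //; apply: measurable_funB => //.
  exact: measurable_psum_past.
have mY1 : measurable_fun setT (Y1 : g_sigma_algebraType (past xi k) -> R).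
  apply: measurable_funM => //; apply: measurableT_comp => //.
  by apply: measurableT_comp mv; exact: measurable_phi0.
have mY2 : measurable_fun setT (Y2 : g_sigma_algebraType (past xi k) -> R).
  apply: measurable_funM => //; apply: measurable_funM => //.
  by apply: measurableT_comp mv; exact: measurable_phi0.
have mY3 : measurable_fun setT (Y3 : g_sigma_algebraType (past xi k) -> R).
  apply: measurable_funM => //; apply: measurableT_comp => //.
  apply: measurable_funM => //; apply: measurableT_comp => //.
  exact: measurable_funX.
have Y1M w : `|Y1 w| <= q^-1.
  rewrite normrM normrN (ger0_norm (phi0_ge0 _)) ger0_norm ?invr_ge0 ?(ltW q0)//.
  rewrite ler_piMl ?invr_ge0 ?(ltW q0)// (le_trans (phi0_le _))// expR_le1.
  by have := sqr_ge0 (v w); lra.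
have Y2M w : `|Y2 w| <= (2 * tau)^-1.
  rewrite normrM (@ger0_norm _ (_^-1)) ?invr_ge0 ?mulr_ge0 ?(ltW tau0)//.
  by rewrite ler_piMl ?invr_ge0 ?mulr_ge0 ?(ltW tau0)// norm_phi0_le1.
have Y3M w : `|Y3 w| <= tau^-1.
  rewrite ger0_norm ?divr_ge0 ?expR_ge0 ?(ltW tau0)//.
  rewrite ler_piMl ?invr_ge0 ?(ltW tau0)// expR_le1.
  by have := sqr_ge0 (v w); lra.
have pm := @past_measurable _ _ _ xi k (dv_meas H).
have iY1 : P.-integrable setT (fun w => (Y1 w * xi k w)%:E).
  apply: bounded_mul_integrable Y1M (dv_int H kn).
  exact: sub_sigma_measurable_fun mY1.
have iY2 : P.-integrable setT (fun w => (Y2 w * xi k w ^+ 2)%:E).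
  apply: bounded_mul_integrable Y2M (dv_int2 H kn).
  exact: sub_sigma_measurable_fun mY2.
have iY3 : P.-integrable setT (fun w => (Y3 w * xi k w ^+ 2)%:E).
  apply: bounded_mul_integrable Y3M (dv_int2 H kn).
  exact: sub_sigma_measurable_fun mY3.
have iY2' : P.-integrable setT (EFin \o Y2).
  by apply: bounded_integrable Y2M; exact: sub_sigma_measurable_fun mY2.
have iY3' : P.-integrable setT (EFin \o Y3).
  by apply: bounded_integrable Y3M; exact: sub_sigma_measurable_fun mY3.
have iPhi j t : P.-integrable setT (fun w => (Phi ((x - S j w) / t))%:E).
  apply: (@bounded_integrable _ _ _ P 1).
    apply: measurableT_comp; first exact: measurable_Phi.
    apply: measurable_funM => //; apply: measurable_funB => //.
    exact: measurable_psum.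
  by move=> w; rewrite ger0_norm ?Phi_ge0 ?Phi_le1.
(* The increment of the telescoped function, corrected by terms of zero integral: the first by the
   martingale property, the second by the deterministic conditional variance. *)
pose D w := Phi ((x - S k.+1 w) / q) - Phi ((x - S k w) / q')
  - Y1 w * xi k w + (Y2 w * xi k w ^+ 2 - a k ^+ 2 * Y2 w).
pose g w := lindC * y * (Y3 w * xi k w ^+ 2 + a k ^+ 2 * Y3 w)
  + lindC * y `^ (2 - p) * (q `^ (- p) * `|xi k w| `^ p + a' `^ p).
have Dg w : `|D w| <= g w.
  have := Phi_lindeberg (v w) (h w) p2 a'01 b0 bE y01.
  have -> : Phi (v w + h w) = Phi ((x - S k.+1 w) / q).
    by congr Phi; rewrite /v /h /psum big_ord_recr/=; field; rewrite gt_eqF.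
  have -> : b * v w = (x - S k w) / q'.
    by rewrite /b /v; field; rewrite !gt_eqF.
  have -> : `|h w| `^ p = q `^ (- p) * `|xi k w| `^ p.
    rewrite /h normrM normrN (@ger0_norm _ q^-1) ?invr_ge0 ?(ltW q0)//.
    rewrite powRM ?invr_ge0 ?(ltW q0)// mulrC; congr (_ * _).
    by rewrite -powR_inv1 ?(ltW q0)// -powRrM mulN1r.
  congr (_ <= _).
    congr (`| _ |); rewrite /D /Y1 /Y2 a'2 /h -q2; field.
    by rewrite gt_eqF.
  rewrite /g /Y3 /h a'2 -q2; field.
  by rewrite gt_eqF.
have iD : P.-integrable setT (EFin \o D).
  apply: integrable_add.
    by apply: integrable_sub => //; apply: integrable_sub; exact: iPhi.
  by apply: integrable_sub => //; exact: integrable_scale.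
have icst (r : R) : P.-integrable setT (EFin \o cst r).
  exact: finite_measure_integrable_cst.
have ig1 : P.-integrable setT
    (fun w => (Y3 w * xi k w ^+ 2 + a k ^+ 2 * Y3 w)%:E).
  by apply: integrable_add => //; exact: integrable_scale.
have ig2 : P.-integrable setT
    (fun w => (q `^ (- p) * `|xi k w| `^ p + a' `^ p)%:E).
  apply: integrable_add; last exact: icst.
  exact/integrable_scale/(dv_intp H kn).
have ig : P.-integrable setT (EFin \o g).
  by apply: integrable_add; exact: integrable_scale.
have := norm_Rintegral_le iD ig Dg.
have -> : \int[P]_w D w = smoothed x theta k.+1 - smoothed x theta k.
  rewrite RintegralD//; last 2 first.
  - by apply: integrable_sub => //; apply: integrable_sub; exact: iPhi.
  - by apply: integrable_sub => //; exact: integrable_scale.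
  rewrite RintegralB//; last by apply: integrable_sub; exact: iPhi.
  rewrite RintegralB//; [|exact: iPhi|exact: iPhi].
  rewrite RintegralB//; last exact: integrable_scale.
  rewrite (dv_mean H kn mY1 Y1M) (dv_var H kn mY2 Y2M) RintegralZl// subr0 subrr addr0.
  by rewrite /smoothed -tauE'.
move=> /le_trans; apply.
rewrite RintegralD//; [|exact: integrable_scale|exact: integrable_scale].
rewrite RintegralZl// RintegralZl//.
rewrite RintegralD//; last exact: integrable_scale.
rewrite RintegralD//; [|exact/integrable_scale/(dv_intp H kn)|exact: icst].
rewrite (dv_var H kn mY3 Y3M) RintegralZl// RintegralZl//; last exact: (dv_intp H kn).
rewrite Rintegral_cstP.
(* The exponent v^2/8 equals (x - S_k)^2 / (2 * (4 tau)), whence the window at scale [4 * tau]. *)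
have -> : \int[P]_w Y3 w = window x (4 * tau) k / tau.
  rewrite /Y3 RintegralZr; [|exact: measurableT|].
  - congr (_ / _); apply: eq_Rintegral => w _; congr expR.
    by rewrite /v expr_div_n q2; field; rewrite gt_eqF.
  - have -> : (fun w => expR (- v w ^+ 2 / 8)) = (fun w => tau * Y3 w).
      by apply/funext => w; rewrite /Y3 mulrCA divff ?mulr1// gt_eqF.
    exact: integrable_scale.
rewrite [leRHS]mulrDr; apply: lerD.
  by rewrite le_eqVlt; apply/orP; left; apply/eqP; ring.
rewrite -mulrA; apply: ler_wpM2l; first exact: ltW lindC_gt0.
apply: ler_wpM2l; first exact: powR_ge0.
rewrite mulrDl mul1r; apply: lerD => //.
have -> : (`|a k| / q) `^ p = q `^ (- p) * `|a k| `^ p.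
  rewrite powRM ?invr_ge0 ?(ltW q0)// mulrC; congr (_ * _).
  by rewrite -powR_inv1 ?(ltW q0)// -powRrM mulN1r.
rewrite mulrCA ler_wpM2l ?powR_ge0//; exact: (dv_mom H kn).
Qed.
End lindeberg_step.

(** Compares one term of a Riemann sum with a decrement of the power it sums to. From ln(1+u) >= u/2
    on [0,1] one gets (1+u)^g >= 1 + g u/2 with g = 1/(p-2), so the ratio of [u] to the decrement is
    at most 2/g + u <= 2/g + 1 = 2p - 3. *)
Lemma telescope_powR {R : realType} (p u : R) : 2 < p -> 0 <= u <= 1 ->
  u <= (2 * p - 3) * (1 - (1 + u) `^ (- (p - 2)^-1)).
Proof.
move=> p2 /andP[u0 u1]; have u10 : 0 < 1 + u by rewrite ltr_pwDl.
set g := (p - 2)^-1; have g0 : 0 < g by rewrite invr_gt0; lra.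
have gE : g * (p - 2) = 1 by rewrite mulVf// gt_eqF//; lra.
rewrite powRN; set W := (1 + u) `^ g.
have lnu : u / 2 <= ln (1 + u).
  have : ln (1 + u)^-1 <= (1 + u)^-1 - 1.
    rewrite -[X in ln X](addrNK 1) addrC le_ln1Dx//.
    by rewrite ltrBrDl subrr invr_gt0.
  rewrite lnV ?posrE// => h.
  apply: (@le_trans _ _ (1 - (1 + u)^-1)); last by lra.
  have -> : 1 - (1 + u)^-1 = u / (1 + u) by field; rewrite gt_eqF.
  by rewrite ler_wpM2l// lef_pV2 ?posrE//; lra.
have W1 : 1 + g * (u / 2) <= W.
  rewrite /W /powR gt_eqF//; apply: le_trans (expR_ge1Dx _).
  by rewrite lerD2l ler_wpM2l// ltW.
have W0 : 0 < W by apply: lt_le_trans W1; rewrite ltr_wpDr// !mulr_ge0// ltW.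
rewrite -(ler_pM2r W0) -mulrA [(1 - _) * W]mulrBl mul1r mulVf ?gt_eqF//.
have h : 1 + g * (u / 2) <= W by [].
have : (2 * p - 3 - u) * (1 + g * (u / 2)) <= (2 * p - 3 - u) * W.
  by rewrite ler_wpM2l//; lra.
have -> : (2 * p - 3 - u) * (1 + g * (u / 2)) =
  2 * p - 3 - u + (u / 2) * ((2 * (g * (p - 2)) + g) - g * u) by field.
rewrite gE.
have : 0 <= (u / 2) * (g * (1 - u)).
  by apply: mulr_ge0; [lra|apply: mulr_ge0; lra].
lra.
Qed.

Section lindeberg_bound.
Context {d : measure_display} {T : measurableType d} {R : realType}.
Variables (P : probability T R) (n : nat) (xi : nat -> T -> R) (a : nat -> R).
Variables (p A : R).
Hypotheses (p2 : 2 < p) (A0 : 0 <= A) (H : det_var_mds P n xi a p A).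

Local Notation rem := (rem n a).
Local Notation smoothed := (smoothed P n xi a).
Local Notation window := (window P xi).

Lemma lindeberg_bound (x theta w B c : R) k : (k <= n)%N -> 0 < w ->
  w ^+ 2 <= theta -> (forall i, (i < n)%N -> a i ^+ 2 <= w ^+ 2) ->
  0 <= B -> 0 < c <= 1 ->
  (forall j tau, (j < k)%N -> w ^+ 2 + rem j <= tau ->
     window x tau j <= B * Num.sqrt tau) ->
  `|smoothed x theta k - smoothed x theta 0| <=
    lindC * (4 * c * B * w * (2 * p - 3)
           + c `^ (2 - p) * w `^ (- p) * (A + 1) * \sum_(i < n) `|a i| `^ p).
Proof.
move=> kn w0 wtheta aw B0 c01 N; have /andP[c0 c1] := c01.
have p2' := p2; have A0' := A0; have p20 : 0 < p - 2 by rewrite subr_gt0.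
set g := (p - 2)^-1; have g0 : 0 < g by rewrite invr_gt0.
have gE : g * (p - 2) = 1 by rewrite mulVf// gt_eqF.
(* A potential increasing along the sequence of variances: its increments dominate the localized
   errors, and it never exceeds 1 on the range in use. *)
pose F t := (w ^+ 2 / t) `^ g.
have th0 : 0 < theta by apply: lt_le_trans wtheta; rewrite exprn_gt0.
have tau_ge j : w ^+ 2 <= theta + rem j by rewrite ler_wpDr// rem_ge0.
have tau_gt0 j : 0 < theta + rem j by rewrite ltr_wpDr// rem_ge0.
have F0 t : 0 <= F t by exact: powR_ge0.
have w20 : 0 < w ^+ 2 by rewrite exprn_gt0.
(* Keeping the increment of [F] and the partial sum of the weights makes the claim additive in [j];
   both are bounded by their totals only at the end. *)
suff : forall j, (j <= k)%N ->
  `|smoothed x theta j - smoothed x theta 0| <=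
    lindC * (4 * c * B * w * (2 * p - 3) * (F (theta + rem j) - F (theta + rem 0))
           + c `^ (2 - p) * w `^ (- p) * (A + 1) * \sum_(i < j) `|a i| `^ p).
  move=> /(_ k (leqnn _)) /le_trans; apply; apply: ler_wpM2l; first exact: ltW lindC_gt0.
  apply: lerD.
    rewrite ler_piMr//.
      by rewrite !mulr_ge0 ?(ltW c0) ?(ltW w0)//; lra.
    have : F (theta + rem k) <= 1; last by have := F0 (theta + rem 0); lra.
    rewrite /F -(powRr0 (w ^+ 2 / (theta + rem k))).
    apply: ger_powR; last exact: ltW.
    by rewrite divr_gt0//= ler_pdivrMr// mul1r.
  apply: ler_wpM2l.
    by rewrite !mulr_ge0 ?powR_ge0//; lra.
  rewrite (big_ord_widen n (fun i => `|a i| `^ p))// big_mkcond/=.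
  by apply: ler_sum => i _; case: ifP => // _; exact: powR_ge0.
elim=> [_|j IH jk].
  by rewrite !subrr normr0 big_ord0 !mulr0 addr0 mulr0.
have jn : (j < n)%N by apply: leq_trans kn.
have {}IH := IH (ltnW jk).
have insert_mid (u v z : R) : u - v = (z - v) + (u - z) by ring.
rewrite (insert_mid _ _ (smoothed x theta j)).
apply: (le_trans (ler_normD _ _)); rewrite big_ord_recr/=.
set tau := theta + rem j.+1.
have t0 : 0 < tau by exact: tau_gt0.
have wt : w ^+ 2 <= tau by exact: tau_ge.
have tE : theta + rem j = tau + a j ^+ 2 by rewrite /tau (remS _ jn) addrA.
set q := Num.sqrt tau.
have q0 : 0 < q by rewrite sqrtr_gt0.
have q2 : q ^+ 2 = tau by rewrite sqr_sqrtr// ltW.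
have wq : w <= q by rewrite -(@ler_pXn2r _ 2)// ?nnegrE ?(ltW w0) ?(ltW q0)// q2.
pose y := c * ((w / q) `^ (1 + 2 * g)).
have wq1 : 0 < w / q <= 1 by rewrite divr_gt0//= ler_pdivrMr// mul1r.
have y01 : 0 < y <= 1.
  rewrite mulr_gt0 ?powR_gt0 ?divr_gt0//= mulr_ile1 ?powR_ge0 ?(ltW c0)//.
  by rewrite -[leRHS](powRr0 (w / q)); apply: ger_powR => //; rewrite addr_ge0// mulr_ge0// ltW.
have at2 : a j ^+ 2 <= tau by apply: le_trans wt; exact: aw.
have := lindeberg_step p2 H x jn (erefl tau) t0 at2 y01.
have Nj : window x (4 * tau) j <= B * (2 * q).
  have -> : 2 * q = Num.sqrt (4 * tau).
    rewrite sqrtrM// -/q; congr (_ * _).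
    by rewrite (_ : 4 = 2 ^+ 2) ?sqrtr_sqr ?ger0_norm//; ring.
  apply: N => //.
  have h1 : rem j = tau + a j ^+ 2 - theta by rewrite -tE addrAC subrr add0r.
  have h2 := aw _ jn; have h3 := rem_ge0 n a j.+1.
  have h4 : theta <= tau by rewrite lerDl.
  rewrite h1; move: wtheta h2 h4 t0; set w2 := w ^+ 2; set a2 := a j ^+ 2; lra.
move=> /(lerD IH) /le_trans; apply.
rewrite -mulrDr; apply: ler_wpM2l; first exact: ltW lindC_gt0.
have yE : y `^ (2 - p) * (`|a j| / q) `^ p = c `^ (2 - p) * w `^ (- p) * `|a j| `^ p.
  rewrite /y (@powRM _ c) ?(ltW c0) ?powR_ge0// -powRrM.
  (* This identity dictates the exponent in [y]: raising to the power 2 - p produces exactly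
     (w/q)^(-p), which cancels the powers of [q] in the moment term. *)
  have -> : (1 + 2 * g) * (2 - p) = - p.
    have -> : (1 + 2 * g) * (2 - p) = 2 - p - 2 * (g * (p - 2)) by ring.
    by rewrite gE; ring.
  have qi0 : 0 < q^-1 by rewrite invr_gt0.
  rewrite powRM ?(ltW w0) ?(ltW qi0)// (@powRM _ `|a j|) ?(ltW qi0)//.
  rewrite (powRN q^-1); field.
  by rewrite gt_eqF ?powR_gt0.
have tel : y * (2 * a j ^+ 2 / tau) * window x (4 * tau) j <=
    4 * c * B * w * (2 * p - 3) * (F tau - F (theta + rem j)).
  pose u := a j ^+ 2 / tau.
  have u01 : 0 <= u <= 1 by rewrite divr_ge0 ?sqr_ge0 ?(ltW t0)//= ler_pdivrMr// mul1r.
  have Ftau : (w / q) `^ (2 * g) = F tau.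
    rewrite powRrM powR_mulrn ?(ltW (andP wq1).1)//.
    by rewrite /F expr_div_n q2.
  have Fj : F (theta + rem j) = F tau * (1 + u) `^ (- g).
    have u10 : 0 < 1 + u by case/andP: u01 => ? _; rewrite ltr_pwDl.
    rewrite /F tE -mulN1r powRrM powR_inv1 ?(ltW u10)// -powRM.
    - by congr (_ `^ _); rewrite /u; field; rewrite !gt_eqF// ltr_wpDr// sqr_ge0.
    - by rewrite divr_ge0 ?(ltW w20) ?(ltW t0).
    - by rewrite invr_ge0 ltW.
  have y2 : y * (2 * a j ^+ 2 / tau) * (B * (2 * q)) = 4 * c * B * w * (F tau * u).
    have /andP[wq0 _] := wq1.
    rewrite /y (@powRD _ (w / q)) ?(gt_eqF wq0) ?implybT// powRr1 ?(ltW wq0)//.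
    by rewrite Ftau /u; field; rewrite !gt_eqF.
  have : y * (2 * a j ^+ 2 / tau) * window x (4 * tau) j <= 4 * c * B * w * (F tau * u).
    rewrite -y2; apply: ler_wpM2l Nj; apply: mulr_ge0; first exact: ltW (andP y01).1.
    by rewrite divr_ge0 ?(ltW t0)// mulr_ge0// sqr_ge0.
  move=> /le_trans; apply; rewrite -(mulrA _ (2 * p - 3)); apply: ler_wpM2l.
    by rewrite !mulr_ge0 ?(ltW c0) ?(ltW w0).
  have := ler_wpM2l (F0 tau) (telescope_powR p2 u01).
  by rewrite Fj -/g => /le_trans; apply; rewrite le_eqVlt; apply/orP; left; apply/eqP; ring.
have sum_up (u0 u1 u2 u3 z s t W : R) : W <= u1 * (u2 - u3) ->
    (u1 * (u3 - u0) + z * (A + 1) * s) + (W + (A + 1) * (z * t))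
      <= u1 * (u2 - u0) + z * (A + 1) * (s + t) by lra.
by rewrite -/q [y `^ (2 - p) * _]mulrCA yE; exact: sum_up tel.
Qed.
End lindeberg_bound.

(** * Concentration of the partial sums *)

Section window_bound.
Context {R : realType}.
Implicit Types p A : R.

(** Chosen so that [windowK * lindC * 4 * c * B * (2 * p - 3)] is [B / 2]. Then [windowB] is the
    solution B of B = B/2 + windowK (1 + lindC c^(2-p) (A+1)), which closes the induction of
    [window_bound]. *)
Definition windowc p : R := (8 * lindC * windowK * (2 * p - 3))^-1.

Definition windowB p A : R :=
  2 * windowK * (1 + lindC * (windowc p `^ (2 - p) * (A + 1))).

Lemma windowK_ge1 : 1 <= windowK :> R.
Proof.
have h1 : 1 <= Num.sqrt (2 * pi) :> R.
  by rewrite -[leLHS]sqrtr1 ler_wsqrtr//; have := pi_ge2 R; lra.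
have h2 : 1 <= expR 2^-1 :> R by apply: le_trans (expR_ge1Dx _); lra.
rewrite /windowK; set u := Num.sqrt _ in h1 *; set v := expR _ in h2 *; nra.
Qed.

Lemma windowB_ge0 p A : 0 <= A -> 0 <= windowB p A.
Proof.
move=> A0; have K0 := @windowK_gt0 R; have C0 := @lindC_gt0 R.
apply: mulr_ge0; first by rewrite mulr_ge0// ltW.
apply: addr_ge0 => //; apply: mulr_ge0; first exact: ltW.
by rewrite mulr_ge0 ?powR_ge0// addr_ge0.
Qed.

Lemma integrable_Phi d (T : measurableType d) (P : probability T R)
    (f : T -> R) (x t : R) :
  measurable_fun setT f -> P.-integrable setT (fun w => (Phi ((x - f w) / t))%:E).
Proof.
move=> mf; apply: (@bounded_integrable _ _ _ P 1).
  apply: measurableT_comp; first exact: measurable_Phi.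
  by apply: measurable_funM => //; apply: measurable_funB.
by move=> w; rewrite ger0_norm ?Phi_ge0 ?Phi_le1.
Qed.

Lemma Phi_window_lip (x s t : R) : 0 <= s -> 1 <= t ->
  Phi ((x + s) / t) - Phi ((x - s) / t) <= 2 * s.
Proof.
move=> s0 t1; have t0 : 0 < t by lra.
have [u _ ->] := mean_value ((x - s) / t) ((x + s) / t) is_derive_Phi.
have -> : (x + s) / t - (x - s) / t = t^-1 * (2 * s) by field; rewrite gt_eqF.
have h : phi0 ((x - s) / t + u * (t^-1 * (2 * s))) <= 1.
  by rewrite (le_trans (phi0_le _))// expR_le1; have := sqr_ge0 ((x - s) / t + u * (t^-1 * (2 * s))); lra.
rewrite mulrA ler_piMl ?mulr_ge0// mulr_ile1 ?phi0_ge0 ?invr_ge0 ?(ltW t0)//.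
by rewrite invf_le1.
Qed.

Lemma perturbed_increment (K u1 u2 v1 v2 e t : R) : 0 < K ->
  u1 <= v1 + e -> v2 - e <= u2 -> v1 - v2 <= 2 * t ->
  K / 2 * (u1 - u2) <= K * (t + e).
Proof.
by move=> K2 e1 e2 e3; rewrite -mulrA; apply: ler_wpM2l; [exact: ltW|lra].
Qed.

Section fixed.
Context {d : measure_display} {T : measurableType d}.
Variables (P : probability T R) (n : nat) (xi : nat -> T -> R) (a : nat -> R).
Variables (p A : R).
Hypotheses (p2 : 2 < p) (A0 : 0 <= A) (H : det_var_mds P n xi a p A).
Hypothesis (a1 : rem n a 0 = 1).
Variable w : R.
Hypotheses (w01 : 0 < w <= 1) (Lw : \sum_(i < n) `|a i| `^ p <= w `^ (p + 1)).

(** A single |a_i|^p is at most the whole sum, hence at most w^(p+1) <= w^p; this is the only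
    obstacle to taking [theta] as small as [w ^+ 2]. *)
Lemma sqr_weight_le i : (i < n)%N -> a i ^+ 2 <= w ^+ 2.
Proof.
move=> ni; have /andP[w0 w1] := w01; have p0 : 0 < p by apply: lt_trans p2.
rewrite -(real_normK (num_real (a i))) lerXn2r ?nnegrE ?(ltW w0)//.
rewrite leNgt; apply/negP => /(gt0_ltr_powR p0); rewrite !nnegrE ltW// normr_ge0.
move=> /(_ isT isT); apply/negP; rewrite -leNgt.
apply: (@le_trans _ _ (\sum_(i < n) `|a i| `^ p)).
  by rewrite (bigD1 (Ordinal ni))//= lerDl sumr_ge0// => j _; exact: powR_ge0.
by apply: (le_trans Lw); apply: ger_powR => //; rewrite lerDl.
Qed.

Lemma powR_weight_le : w `^ (- p) * \sum_(i < n) `|a i| `^ p <= w.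
Proof.
have /andP[w0 w1] := w01.
apply: (le_trans (ler_wpM2l (powR_ge0 _ _) Lw)).
by rewrite -powRD ?(gt_eqF w0) ?implybT// addrA addNr add0r powRr1 ?(ltW w0).
Qed.

Lemma smoothed0 x theta :
  smoothed P n xi a x theta 0 = Phi (x / Num.sqrt (theta + 1)).
Proof.
rewrite /smoothed a1 -[RHS](Rintegral_cstP P); apply: eq_Rintegral => t _.
by rewrite /psum big_ord0 subr0.
Qed.

(** The bump is dominated by an increment of [Phi] over a window of half-width sqrt(tau), that is,
    by a difference of two smoothed probabilities. Telescoping moves both to step 0, where the law
    is Gaussian of variance at least 1 and the increment is O(sqrt tau). The error involves windows
    at earlier steps but at other scales, so the induction must quantify over all [x] and [tau]. *)
Lemma window_bound k : (k <= n)%N -> forall x tau,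
  w ^+ 2 + rem n a k <= tau ->
  window P xi x tau k <= windowB p A * Num.sqrt tau.
Proof.
have /andP[w0 w1] := w01; have p2' := p2; have A0' := A0.
have K0 := @windowK_gt0 R; have K1 := windowK_ge1.
have p3 : 0 < 2 * p - 3 by lra.
elim/ltn_ind: k => k IH kn x tau wtau.
have t0 : 0 < tau.
  by apply: lt_le_trans wtau; rewrite ltr_wpDr ?rem_ge0// exprn_gt0.
set s := Num.sqrt tau; have s0 : 0 < s by rewrite sqrtr_gt0.
have s2 : s ^+ 2 = tau by rewrite sqr_sqrtr// ltW.
(* With this choice the smoothing scale at step [k] is exactly sqrt(tau), and the hypothesis on
   [tau] becomes [w ^+ 2 <= theta]. *)
pose theta := tau - rem n a k.
have thE : theta + rem n a k = tau by rewrite subrK.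
have wth : w ^+ 2 <= theta by rewrite lerBrDr.
set c : R := windowc p; set B := windowB p A.
have D0 : 0 < 8 * lindC * windowK * (2 * p - 3) by rewrite mulr_gt0// mulr_gt0// mulr_gt0 ?lindC_gt0.
have c01 : 0 < c <= 1.
  rewrite invr_gt0 D0/= invf_le1//.
  have h1 : 1 <= windowK * (2 * p - 3) by nra.
  have h2 : 1 <= 8 * @lindC R by rewrite /lindC -lock; lra.
  by rewrite -mulrA mulr_ege1.
have B0 : 0 <= B := windowB_ge0 p A0.
have N j tau' : (j < k)%N -> w ^+ 2 + rem n a j <= tau' ->
    window P xi x tau' j <= B * Num.sqrt tau'.
  by move=> jk; apply: IH => //; apply: leq_trans kn; exact: ltnW.
have LB y : (forall j tau', (j < k)%N -> w ^+ 2 + rem n a j <= tau' ->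
    window P xi y tau' j <= B * Num.sqrt tau') ->
  `|smoothed P n xi a y theta k - smoothed P n xi a y theta 0| <=
    lindC * (4 * c * B * w * (2 * p - 3)
           + c `^ (2 - p) * w `^ (- p) * (A + 1) * \sum_(i < n) `|a i| `^ p).
  by move=> Ny; apply: lindeberg_bound => //; exact: sqr_weight_le.
have L1 := LB (x + s) (fun j tau' jk => IH j jk (ltnW (leq_trans jk kn)) _ tau').
have L2 := LB (x - s) (fun j tau' jk => IH j jk (ltnW (leq_trans jk kn)) _ tau').
move: L1 L2; rewrite !smoothed0.
set E := lindC * _ => L1 L2.
have E_le : E <= lindC * (4 * c * B * (2 * p - 3) + c `^ (2 - p) * (A + 1)) * s.
  have ws : w <= s.
    rewrite -(@ler_pXn2r _ 2)// ?nnegrE ?(ltW w0) ?(ltW s0)// s2.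
    by apply: le_trans wtau; rewrite lerDl rem_ge0.
  rewrite /E -[leRHS]mulrA; apply: ler_wpM2l; first exact: ltW lindC_gt0.
  rewrite [leRHS]mulrDl; apply: lerD.
    rewrite mulrAC; apply: ler_wpM2l => //.
    by rewrite mulr_ge0 ?(ltW p3)// mulr_ge0// mulr_ge0// ltW; case/andP: c01.
  rewrite -!mulrA; apply: ler_wpM2l; first exact: powR_ge0.
  rewrite mulrCA; apply: ler_wpM2l; first exact: addr_ge0.
  by apply: le_trans ws; exact: powR_weight_le.
have win_le : window P xi x tau k <= windowK / 2 *
    (smoothed P n xi a (x + s) theta k - smoothed P n xi a (x - s) theta k).
  rewrite /window /smoothed thE -/s -RintegralB//; last 2 first.
  - exact/integrable_Phi/(measurable_psum H).
  - exact/integrable_Phi/(measurable_psum H).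
  rewrite -RintegralZl//; last first.
    by apply: integrable_sub; apply: integrable_Phi; exact: measurable_psum H _.
  apply: le_Rintegral => //.
  - apply: (@bounded_integrable _ _ _ P 1).
      apply: measurableT_comp => //; apply: measurable_funM => //.
      apply: measurableT_comp => //; apply: measurable_funX.
      by apply: measurable_funB => //; exact: measurable_psum H _.
    move=> t; rewrite ger0_norm ?expR_ge0// expR_le1 mulNr oppr_le0.
    by rewrite divr_ge0 ?sqr_ge0// mulr_ge0// ltW.
  - apply/integrable_scale/integrable_sub; apply: integrable_Phi; exact: measurable_psum H _.
  - move=> t _.
    have := gauss_le_window ((x - psum xi k t) / s).
    have -> : (x - psum xi k t) / s + 1 = (x + s - psum xi k t) / s.
      by field; rewrite gt_eqF.
    have -> : (x - psum xi k t) / s - 1 = (x - s - psum xi k t) / s.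
      by field; rewrite gt_eqF.
    suff -> : - (x - psum xi k t) ^+ 2 / (2 * tau) =
      - ((x - psum xi k t) / s) ^+ 2 / 2 by [].
    by rewrite expr_div_n s2; field; rewrite gt_eqF.
apply: (le_trans win_le).
have := @Phi_window_lip x s (Num.sqrt (theta + 1)) (ltW s0).
have th1 : 1 <= Num.sqrt (theta + 1).
  rewrite -[leLHS]sqrtr1 ler_wsqrtr// lerDr.
  by apply: le_trans wth; exact: sqr_ge0.
move=> /(_ th1); move: L1 L2; rewrite !ler_distl.
set U1 := smoothed _ _ _ _ _ _ _; set U2 := smoothed _ _ _ _ _ _ _.
set V1 := Phi _; set V2 := Phi _ => /andP[_ h1] /andP[h2 _] h3.
apply: (@le_trans _ _ (windowK * (s + E))).
  exact: perturbed_increment K0 h1 h2 h3.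
apply: (@le_trans _ _ (windowK * (s + lindC *
    (4 * c * B * (2 * p - 3) + c `^ (2 - p) * (A + 1)) * s))).
  by apply: ler_wpM2l; [exact: ltW|rewrite lerD2l].
have cE : 8 * lindC * windowK * (2 * p - 3) * c = 1.
  by rewrite mulfV// gt_eqF.
have BE : B = 2 * windowK * (1 + lindC * (c `^ (2 - p) * (A + 1))) by [].
set G := c `^ (2 - p) * (A + 1) in BE *.
have -> : windowK * (s + lindC * (4 * c * B * (2 * p - 3) + G) * s) =
  (8 * lindC * windowK * (2 * p - 3) * c) * B * s / 2 +
  2 * windowK * (1 + lindC * G) * s / 2 by field.
have half (b t : R) : 1 * b * t / 2 + b * t / 2 = b * t by field.
by rewrite cE -BE half.
Qed.
End fixed.
End window_bound.

(** * The range of moderate x *)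

Section weights.
Context {R : realType}.
Variables (n : nat) (a : nat -> R) (p : R).
Hypotheses (p2 : 2 < p) (a1 : rem n a 0 = 1).

Let L := \sum_(i < n) `|a i| `^ p.

Lemma sum_sqr1 : \sum_(i < n) a i ^+ 2 = 1.
Proof. by rewrite -a1 /rem big_mkord. Qed.

Lemma weight_le1 i : (i < n)%N -> `|a i| <= 1.
Proof.
move=> ni; rewrite -(@expr_le1 _ 2)// real_normK ?num_real//.
rewrite -sum_sqr1 (bigD1 (Ordinal ni))//= lerDl sumr_ge0// => j _.
exact: sqr_ge0.
Qed.

Lemma weights_gt0 : 0 < L.
Proof.
have L0 : 0 <= L by apply: sumr_ge0 => i _; exact: powR_ge0.
rewrite lt_neqAle L0 andbT; apply/eqP => LE.
have : \sum_(i < n) a i ^+ 2 = 0.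
  apply: big1 => i _; have : `|a i| `^ p = 0.
    apply/eqP; rewrite eq_le powR_ge0 andbT [leRHS]LE /L (bigD1 i)//= lerDl.
    by apply: sumr_ge0 => j _; exact: powR_ge0.
  by move=> /powR_eq0_eq0/eqP; rewrite normr_eq0 => /eqP ->; rewrite expr0n.
by rewrite sum_sqr1 => /eqP; rewrite oner_eq0.
Qed.

Lemma weights_le1 : L <= 1.
Proof.
rewrite -sum_sqr1; apply: ler_sum => i _.
have [->|ai0] := eqVneq (a i) 0.
  by rewrite normr0 powR0 ?sqr_ge0// gt_eqF// (lt_trans _ p2).
rewrite -(real_normK (num_real (a i))) -powR_mulrn//.
by apply: ger_powR; rewrite ?normr_gt0 ?ai0 ?weight_le1// ltW.
Qed.

Lemma weights_root : (L `^ (1 / (1 + p))) `^ (1 + p) = L.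
Proof.
rewrite -powRrM mul1r mulVf ?powRr1 ?(ltW weights_gt0)//.
by rewrite gt_eqF// ltr_wpDr ?(ltW (lt_trans _ p2)).
Qed.

Lemma weights_le_root : L <= L `^ (1 / (1 + p)).
Proof.
have p0 : 0 < p by exact: lt_trans p2.
rewrite -[leLHS]powRr1 ?(ltW weights_gt0)//.
apply: ger_powR; first by rewrite weights_gt0 weights_le1.
by rewrite ler_pdivrMr ?mul1r ?lerDl ?ltr_wpDr// ltW.
Qed.

End weights.

Section middle_range.
Context {R : realType}.

Definition middleC (p A : R) : R :=
  lindC * (4 * windowB p A * (2 * p - 3) + (A + 1)).

Definition middleD (p : R) : R :=
  (4 * windowK + lindC) * expR (2 * (p ^+ 2 + p) ^+ 2).

(* The window width is a power of [1 + |x|] larger than the optimal uniform one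
   and the truncation parameter [c] is correspondingly smaller. *)
Lemma scaled_window (p del x L : R) : 2 < p -> 0 < del -> del `^ (1 + p) = L ->
  let X := 1 + `|x| in let w := del * X `^ (p ^+ 2) in
  let c := X `^ (- (p ^+ 2 + p)) in
  [/\ 0 < c <= 1, 0 < w, L <= w `^ (p + 1), c * w = del * X `^ (- p) &
      c `^ (2 - p) * w `^ (- p) * L <= del * X `^ (- p) /\
      w * expR (- x ^+ 2 / 8) <=
        expR (2 * (p ^+ 2 + p) ^+ 2) * (del * X `^ (- p))].
Proof.
move=> p2 d0 dL X w c.
have p0 : 0 < p by lra.
have X1 : 1 <= X by rewrite lerDl.
have X0 : 0 < X by apply: lt_le_trans X1.
have m0 : 0 < p ^+ 2 by rewrite exprn_gt0.
have Xm1 : 1 <= X `^ (p ^+ 2).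
  by rewrite -[leLHS](powRr0 X); apply: ler_powR => //; exact: ltW.
have w0 : 0 < w by rewrite mulr_gt0 ?powR_gt0.
have XD (u v : R) : X `^ u * X `^ v = X `^ (u + v).
  by rewrite powRD ?(gt_eqF X0) ?implybT.
have DD (u v : R) : del `^ u * del `^ v = del `^ (u + v).
  by rewrite powRD ?(gt_eqF d0) ?implybT.
split => //; last split.
- rewrite powR_gt0//= -[leRHS](powRr0 X); apply: ler_powR => //.
  by rewrite oppr_le0 addr_ge0 ?ltW.
- rewrite -dL addrC ge0_ler_powR ?nnegrE ?(ltW d0) ?(ltW w0)//.
    by rewrite addr_ge0 ?(ltW p0).
  by rewrite ler_peMr// ltW.
- rewrite /c /w mulrCA XD; congr (_ * X `^ _); ring.
- rewrite /c /w -dL (powRM _ (ltW d0) (powR_ge0 _ _)) -!powRrM.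
  have -> : X `^ (- (p ^+ 2 + p) * (2 - p)) * (del `^ (- p) * X `^ (p ^+ 2 * - p))
      * del `^ (1 + p) = (del `^ (- p) * del `^ (1 + p)) *
      (X `^ (- (p ^+ 2 + p) * (2 - p)) * X `^ (p ^+ 2 * - p)) by ring.
  rewrite DD XD (_ : - p + (1 + p) = 1); last by ring.
  rewrite powRr1 ?(ltW d0)// ler_wpM2l ?(ltW d0)//; apply: ler_powR => //.
  by have := sqr_ge0 p; nra.
- have q0 : 0 <= p ^+ 2 + p by rewrite addr_ge0 ?ltW.
  apply: (le_trans (ler_wpM2l (ltW w0) (gauss_decay x q0))).
  rewrite /w mulrCA -/X -mulrA XD; apply: ler_wpM2l; first exact: expR_ge0.
  by rewrite (_ : p ^+ 2 + - (p ^+ 2 + p) = - p); [exact: lexx|ring].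
Qed.

(** [pr] is the probability, [s0], [s1], [s2] its smoothed versions at x, x + w, x - w, and [f0],
    [f1], [f2] their Gaussian values. The Lindeberg error [e] is paid once at x and, through the
    window, with weight [K] at each of the shifted points. *)
Lemma smoothing_triangle (K M g e pr s0 s1 s2 f0 f1 f2 f : R) : 0 < K ->
  `|pr - s0| <= K * (s1 - s2) -> `|s0 - f0| <= e -> `|s1 - f1| <= e ->
  `|s2 - f2| <= e -> f1 - f2 <= 4 * g -> `|f0 - f| <= M * g ->
  `|pr - f| <= (4 * K + M) * g + (2 * K + 1) * e.
Proof.
rewrite !ler_distl => K0 /andP[h1 h2] /andP[h3 h4] /andP[h5 h6] /andP[h7 h8] h9.
move=> /andP[h10 h11].
have : K * (s1 - s2) <= K * (4 * g + 2 * e) by apply: ler_wpM2l; lra.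
move=> h; apply/andP; split; lra.
Qed.

Section fixed.
Context {d : measure_display} {T : measurableType d}.
Variables (P : probability T R) (n : nat) (xi : nat -> T -> R) (a : nat -> R).
Variables (p A : R).
Hypotheses (p2 : 2 < p) (A0 : 0 <= A) (H : det_var_mds P n xi a p A).
Hypothesis (a1 : rem n a 0 = 1).

Let L := \sum_(i < n) `|a i| `^ p.
Let del := L `^ (1 / (1 + p)).

Lemma measurable_psum_le x : measurable [set t | psum xi n t <= x].
Proof.
rewrite (_ : mkset _ = psum xi n @^-1` `]-oo, x]); last first.
  by apply/seteqP; split => t /=; rewrite in_itv.
by rewrite -[X in measurable X]setTI; apply: measurable_psum H _ _ _ _.
Qed.

Lemma cdf_smoothed (x w : R) : 0 < w ->
  `|fine (P [set t | psum xi n t <= x]) - smoothed P n xi a x (w ^+ 2) n|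
    <= windowK * (smoothed P n xi a (x + w) (w ^+ 2) n
                  - smoothed P n xi a (x - w) (w ^+ 2) n).
Proof.
move=> w0; have mA := measurable_psum_le x; set E := mkset _.
(* At the last step no variance remains, so the smoothing scale is exactly [w]. *)
have rn : rem n a n = 0 by rewrite /rem big_geq.
have -> : fine (P E) = \int[P]_t (\1_E t).
  by rewrite /Rintegral integral_indic// setIT.
have iI : P.-integrable setT (EFin \o (\1_E : T -> R)).
  exact: integrable_indic.
rewrite /smoothed rn addr0 sqrtr_sqr (gtr0_norm w0).
have iP y := integrable_Phi P y w (measurable_psum H n).
have [iP1 iP2 iP3] := And3 (iP x) (iP (x + w)) (iP (x - w)).
rewrite -!RintegralB// -RintegralZl//; last exact: integrable_sub.
apply: norm_Rintegral_le.
- exact: integrable_sub.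
- by apply: integrable_scale; exact: integrable_sub.
move=> t; have := Phi_sandwich ((x - psum xi n t) / w).
have -> : (x - psum xi n t) / w + 1 = (x + w - psum xi n t) / w.
  by field; rewrite gt_eqF.
have -> : (x - psum xi n t) / w - 1 = (x - w - psum xi n t) / w.
  by field; rewrite gt_eqF.
have -> : (if 0 <= (x - psum xi n t) / w then 1 else 0) = \1_E t :> R.
  rewrite indicE (pmulr_lge0 _ (_ : 0 < w^-1)) ?invr_gt0// subr_ge0.
  by have [xt|xt] := boolP (psum xi n t <= x); [rewrite mem_set|rewrite memNset//; apply/negP].
by rewrite ler_distl.
Qed.

Lemma middle_range (x : R) : del * (1 + `|x|) `^ (p ^+ 2) <= 1 ->
  `|fine (P [set t | psum xi n t <= x]) - Phi x| <=
    (middleD p + (2 * windowK + 1) * middleC p A) * (del * (1 + `|x|) `^ (- p)).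
Proof.
move=> w1.
have d0 : 0 < del by rewrite powR_gt0// weights_gt0.
have dL : del `^ (1 + p) = L by exact: weights_root.
have [] := scaled_window x p2 d0 dL.
set w := del * (1 + `|x|) `^ (p ^+ 2) in w1 *; set c : R := _ `^ (- (_ + p)).
set Q := del * _ `^ (- p).
move=> c01 w0 Lw cw [cwL wexp].
have K0 := @windowK_gt0 R; have B0 := windowB_ge0 p A0.
have w01 : 0 < w <= 1 by rewrite w0 w1.
have LB y := @lindeberg_bound _ _ R P n xi a p A p2 A0 H y (w ^+ 2) w
  (windowB p A) c n (leqnn n) w0 (lexx _) (sqr_weight_le p2 w01 Lw) B0 c01
  (fun j tau jn ht => window_bound p2 A0 H a1 w01 Lw (ltnW jn) y ht).
(* At step 0 the smoothed law is normal of variance 1 + w^2; [b] standardizes it, and the return to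
   variance 1 is the purpose of [Phi_dilation]. *)
pose b := (Num.sqrt (w ^+ 2 + 1))^-1.
have w21 : 0 < w ^+ 2 + 1 by rewrite ltr_wpDl// sqr_ge0.
have b0 : 0 <= b by rewrite invr_ge0 sqrtr_ge0.
have bE : b ^+ 2 * (1 + w ^+ 2) = 1.
  by rewrite exprVn sqr_sqrtr ?(ltW w21)// [1 + _]addrC mulVf// gt_eqF.
have w01' : 0 <= w <= 1 by rewrite ltW.
have f0E y : smoothed P n xi a y (w ^+ 2) 0 = Phi (b * y).
  by rewrite (smoothed0 _ _ a1) mulrC.
set E := expR (- x ^+ 2 / 8) in wexp.
have win : Phi (b * (x + w)) - Phi (b * (x - w)) <= 4 * (w * E).
  by rewrite mulrA; exact: Phi_window.
have dil : `|Phi (b * x) - Phi x| <= lindC * (w * E).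
  by rewrite mulrA; exact: Phi_dilation.
move: LB; set e := lindC * _ => LB.
have L0 := LB x; have L1 := LB (x + w); have L2 := LB (x - w).
rewrite f0E in L0; rewrite f0E in L1; rewrite f0E in L2.
apply: (le_trans (smoothing_triangle K0 (cdf_smoothed x w0) L0 L1 L2 win dil)).
have eQ : e <= middleC p A * Q.
  rewrite /middleC -mulrA; apply: ler_wpM2l; first exact: ltW lindC_gt0.
  rewrite [leRHS]mulrDl; apply: lerD.
    rewrite -cw le_eqVlt; apply/orP; left; apply/eqP; ring.
  rewrite mulrAC [leRHS]mulrC; apply: ler_wpM2r => //; exact: addr_ge0.
rewrite [leRHS]mulrDl; apply: lerD.
  rewrite /middleD -[leRHS]mulrA; apply: ler_wpM2l => //.
  by apply: addr_ge0; [apply: mulr_ge0 => //; exact: ltW|exact: ltW lindC_gt0].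
rewrite -[leRHS]mulrA; apply: ler_wpM2l => //.
by apply: addr_ge0 => //; apply: mulr_ge0 => //; exact: ltW.
Qed.
End fixed.
End middle_range.

(** * The range of large x *)

Lemma sub_sigma_measurable2 {d} {T : pointedType} {U : measurableType d}
    (G G' : set (set T)) (f : T -> U) : G `<=` <<s G' >> ->
  measurable_fun setT (f : g_sigma_algebraType G -> U) ->
  measurable_fun setT (f : g_sigma_algebraType G' -> U).
Proof.
move=> GG' mf _ B mB.
have : <<s G >> (setT `&` f @^-1` B) by apply: mf.
apply: smallest_sub => //; exact: smallest_sigma_algebra.
Qed.

Lemma integrable_Rintegral_sum {d} {T : measurableType d} {R : realType}
    (P : probability T R) (n : nat) (f : nat -> T -> R) :
  (forall i, (i < n)%N -> P.-integrable setT (EFin \o f i)) ->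
  P.-integrable setT (fun w => (\sum_(i < n) f i w)%:E) /\
  \int[P]_w (\sum_(i < n) f i w) = \sum_(i < n) \int[P]_w f i w.
Proof.
elim: n => [_|n IH fi].
  split.
    rewrite (_ : (fun _ => _) = EFin \o cst 0); first exact: finite_measure_integrable_cst.
    by apply/funext => w; rewrite big_ord0.
  rewrite big_ord0 -[RHS](Rintegral_cstP P); apply: eq_Rintegral => w _.
  by rewrite big_ord0.
have [i1 e1] := IH (fun i ni => fi i (ltnW ni)).
have fn := fi n (leqnn _).
rewrite (_ : (fun w => (\sum_(i < n.+1) f i w)%:E) =
  (fun w => ((\sum_(i < n) f i w) + f n w)%:E)); last first.
  by apply/funext => w; rewrite big_ord_recr.
split; first exact: integrable_add.
by under eq_Rintegral do rewrite big_ord_recr/=; rewrite RintegralD// e1 big_ord_recr.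
Qed.

(** * Exponential moments of truncated sums and a Fuk-Nagaev tail *)

Section fuk_nagaev.
Context {R : realType} {d : measure_display} {T : measurableType d}.
Variables (P : probability T R) (n : nat) (a : nat -> R) (p A : R).

Lemma det_var_mdsN (xi : nat -> T -> R) : det_var_mds P n xi a p A ->
  det_var_mds P n (fun k w => - xi k w) a p A.
Proof.
move=> H.
have pastN k : past (fun k w => - xi k w) k `<=` <<s past xi k >>.
  move=> _ [j [B [jk [mB ->]]]]; apply: sub_sigma_algebra.
  exists j, (-%R @^-1` B); split => //; split => //.
  rewrite -[X in measurable X]setTI.
  have mN : measurable_fun setT (fun x : R => - x) by exact: measurable_funN.
  exact: mN.
split.
- by move=> k; apply: measurable_funN; exact: dv_meas H _.
- move=> k kn; rewrite (_ : EFin \o _ = fun w => (-1 * xi k w)%:E).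
    exact/integrable_scale/(dv_int H kn).
  by apply/funext => w /=; rewrite mulN1r.
- by move=> k kn; under eq_fun do rewrite sqrrN; exact: dv_int2 H _ kn.
- by move=> k kn; under eq_fun do rewrite normrN; exact: dv_intp H _ kn.
- move=> k M Y kn mY YM.
  rewrite -[RHS]oppr0 -(dv_mean H kn (sub_sigma_measurable2 (@pastN k) mY) YM).
  have mYT : measurable_fun setT Y.
    by apply: sub_sigma_measurable_fun mY; apply: past_measurable => j;
      apply: measurable_funN; exact: dv_meas H _.
  rewrite -mulN1r -RintegralZl//; last first.
    by apply: bounded_mul_integrable YM (dv_int H kn).
  by apply: eq_Rintegral => w _; rewrite mulrN mulN1r.
- move=> k M Y kn mY YM; under eq_Rintegral do rewrite sqrrN.
  exact: dv_var H _ _ _ kn (sub_sigma_measurable2 (@pastN k) mY) YM.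
- by move=> k kn; under eq_Rintegral do rewrite normrN; exact: dv_mom H _ kn.
Qed.

(** Truncation from above only: since min(u, y) <= u and [l >= 0], the linear term may be stated
    with [u] itself, so it has zero conditional mean and truncation introduces no bias. *)
Lemma expR_minr_le (u l y : R) : 0 <= l -> 0 < y ->
  expR (l * Num.min u y) <= 1 + l * u + l ^+ 2 * u ^+ 2 * expR (l * y).
Proof.
move=> l0 y0; set z := Num.min u y.
have zu : z <= u by rewrite ge_min lexx.
have zy : z <= y by rewrite ge_min lexx orbT.
have z2 : z ^+ 2 <= u ^+ 2.
  rewrite /z /Num.min; case: ifPn => // ; rewrite -leNgt => yu.
  by rewrite lerXn2r ?nnegrE ?(ltW y0)// (le_trans (ltW y0)).
have [t /andP[t0 t1] h] := taylor1 0 (l * z) (@is_derive_expR R) (@is_derive_expR R).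
rewrite !add0r expR0 mulr1 (ger0_norm (expR_ge0 _)) in h.
have e1 : expR (t * (l * z)) <= expR (l * y).
  rewrite ler_expR; have [z0|z0] := leP 0 z.
    by apply: (@le_trans _ _ (l * z)); [rewrite ler_piMl// mulr_ge0|exact: ler_wpM2l].
  by apply: (@le_trans _ _ 0); [rewrite mulr_ge0_le0// mulr_ge0_le0// ltW|rewrite mulr_ge0// ltW].
have e2 : (l * z) ^+ 2 * expR (t * (l * z)) <= l ^+ 2 * u ^+ 2 * expR (l * y).
  by apply: ler_pM; rewrite ?sqr_ge0 ?expR_ge0// exprMn ler_wpM2l ?sqr_ge0.
have e3 : l * z <= l * u by exact: ler_wpM2l.
have := le_trans (ler_norm _) (le_trans h e2); lra.
Qed.

Variable (xi : nat -> T -> R).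
Hypotheses (p2 : 2 < p) (A0 : 0 <= A) (H : det_var_mds P n xi a p A).

Let S' (y : R) k w := \sum_(j < k) Num.min (xi j w) y.

(** Conditionally on the past, each new factor has mean at most 1 + G a_k^2 <= exp(G a_k^2) with G =
    l^2 exp(l y); the bounds multiply because the conditional variances are deterministic. *)
Lemma exp_truncated_psum (l y : R) k : (k <= n)%N -> 0 <= l -> 0 < y ->
  \int[P]_w expR (l * S' y k w) <=
    expR (l ^+ 2 * expR (l * y) * \sum_(i < k) a i ^+ 2).
Proof.
move=> + l0 y0; elim: k => [_|k IH kn].
  rewrite big_ord0 mulr0 -[leRHS](Rintegral_cstP P) le_eqVlt; apply/orP; left.
  by apply/eqP/eq_Rintegral => w _; rewrite /S' big_ord0 mulr0.
have {}IH := IH (ltnW kn).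
pose Y w := expR (l * S' y k w).
have bound j w : `|expR (l * S' y j w)| <= expR (l * (y *+ j)).
  rewrite ger0_norm ?expR_ge0// ler_expR ler_wpM2l//.
  rewrite -[X in y *+ X]card_ord -sumr_const; apply: ler_sum => i _.
  by rewrite ge_min lexx orbT.
have YM w : `|Y w| <= expR (l * (y *+ k)) by exact: bound.
have mY : measurable_fun setT (Y : g_sigma_algebraType (past xi k) -> R).
  apply: measurableT_comp => //; apply: measurable_funM => //.
  apply: measurable_sum => j; apply: measurable_minr => //.
  exact: measurable_past.
have mYT : measurable_fun setT Y.
  by apply: sub_sigma_measurable_fun mY; exact: past_measurable (dv_meas H).
have iY : P.-integrable setT (EFin \o Y) by exact: bounded_integrable mYT YM.
have iY1 := bounded_mul_integrable mYT YM (dv_int H kn).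
have iY2 := bounded_mul_integrable mYT YM (dv_int2 H kn).
pose G := l ^+ 2 * expR (l * y).
have step : \int[P]_w expR (l * S' y k.+1 w) <=
    \int[P]_w (Y w + l * (Y w * xi k w) + G * (Y w * xi k w ^+ 2)).
  apply: le_Rintegral => //.
  - apply: bounded_integrable (bound k.+1).
    apply: measurableT_comp => //; apply: measurable_funM => //.
    apply: measurable_sum => j; apply: measurable_minr => //.
    exact: dv_meas H _.
  - apply: integrable_add; last exact: integrable_scale.
    by apply: integrable_add => //; exact: integrable_scale.
  - move=> w _; rewrite /S' big_ord_recr/= mulrDr expRD -/(Y w).
    have := ler_wpM2l (expR_ge0 (l * S' y k w)) (expR_minr_le (xi k w) l0 y0).
    move=> /le_trans; apply; rewrite -/(Y w) le_eqVlt; apply/orP; left; apply/eqP.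
    by rewrite /G; ring.
apply: (le_trans step).
rewrite RintegralD//; [|apply: integrable_add => //|]; try exact: integrable_scale.
rewrite RintegralD//; last exact: integrable_scale.
rewrite !RintegralZl// (dv_mean H kn mY YM) (dv_var H kn mY YM) mulr0 addr0.
rewrite big_ord_recr/= mulrDr expRD -/G.
have -> : \int[P]_w Y w + G * (a k ^+ 2 * \int[P]_w Y w) =
  \int[P]_w Y w * (1 + G * a k ^+ 2) by ring.
apply: ler_pM => //.
- by apply: Rintegral_ge0 => w _; exact: expR_ge0.
- rewrite addr_ge0// mulr_ge0 ?sqr_ge0//.
  by rewrite mulr_ge0 ?sqr_ge0 ?expR_ge0.
- exact: expR_ge1Dx.
Qed.

(** Either some increment exceeds [y] in absolute value, which the p-th moments control, or
    truncation changes nothing and the exponential Markov inequality applies. Both cases are encoded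
    in one pointwise bound of the indicator. *)
Lemma tail_bound (x l y : R) : rem n a 0 = 1 -> 0 <= l -> 0 < y ->
  fine (P [set w | x <= psum xi n w]) <=
    A * y `^ (- p) * (\sum_(i < n) `|a i| `^ p)
    + expR (l ^+ 2 * expR (l * y) - l * x).
Proof.
move=> a1 l0 y0.
have mE : measurable [set w | x <= psum xi n w].
  rewrite (_ : mkset _ = psum xi n @^-1` `[x, +oo[); last first.
    by apply/seteqP; split => t /=; rewrite in_itv/= andbT.
  by rewrite -[X in measurable X]setTI; apply: measurable_psum H _ _ _ _.
set E := mkset _ in mE *.
pose g w := y `^ (- p) * (\sum_(i < n) `|xi i w| `^ p)
  + expR (- (l * x)) * expR (l * S' y n w).
have is' : P.-integrable setT (fun w => (expR (l * S' y n w))%:E).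
  apply: (@bounded_integrable _ _ _ P (expR (l * (y *+ n)))).
    apply: measurableT_comp => //; apply: measurable_funM => //.
    apply: measurable_sum => j; apply: measurable_minr => //.
    exact: dv_meas H _.
  move=> w; rewrite ger0_norm ?expR_ge0// ler_expR ler_wpM2l//.
  rewrite -[X in y *+ X]card_ord -sumr_const; apply: ler_sum => i _.
  by rewrite ge_min lexx orbT.
have isum : P.-integrable setT (fun w => (\sum_(i < n) `|xi i w| `^ p)%:E).
  by have [] := integrable_Rintegral_sum (dv_intp H).
have -> : fine (P E) = \int[P]_t (\1_E t).
  by rewrite /Rintegral integral_indic// setIT.
have pt w : \1_E w <= g w.
  have g1 : 0 <= y `^ (- p) * (\sum_(i < n) `|xi i w| `^ p).
    by rewrite mulr_ge0 ?powR_ge0// sumr_ge0// => i _; exact: powR_ge0.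
  have g2 : 0 <= expR (- (l * x)) * expR (l * S' y n w).
    by rewrite mulr_ge0 ?expR_ge0.
  rewrite indicE; have [wE|_] := boolP (w \in E); last by rewrite addr_ge0.
  have xw : x <= psum xi n w by move: wE; rewrite inE.
  have [/existsP[i yi]|] := boolP [exists i : 'I_n, y < `|xi i w|].
    apply: (@le_trans _ _ (y `^ (- p) * (\sum_(i < n) `|xi i w| `^ p))); last first.
      by rewrite lerDl.
    rewrite -[leLHS](mulVf (_ : y `^ p != 0)) ?gt_eqF ?powR_gt0// -powRN.
    rewrite ler_wpM2l ?powR_ge0// (bigD1 i)//= ler_wpDr//.
      by rewrite sumr_ge0// => j _; exact: powR_ge0.
    by rewrite ge0_ler_powR ?nnegrE ?(ltW y0) ?(ltW yi)// ltW// (lt_trans _ p2).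
  rewrite negb_exists => /forallP small.
  apply: (@le_trans _ _ (expR (- (l * x)) * expR (l * S' y n w))); last first.
    by rewrite lerDr.
  rewrite -expRD -[leLHS]expR0 ler_expR addrC -mulrBr mulr_ge0// subr_ge0.
  suff -> : S' y n w = psum xi n w by [].
  apply: eq_bigr => i _; apply/min_idPl.
  by apply: le_trans (ler_norm _) _; rewrite leNgt; exact: small.
have ig : P.-integrable setT (EFin \o g).
  by apply: integrable_add; exact: integrable_scale.
apply: (@le_trans _ _ (\int[P]_w g w)).
  by apply: le_Rintegral => //; exact: integrable_indic.
rewrite RintegralD//; [|exact: integrable_scale|exact: integrable_scale].
rewrite !RintegralZl//; apply: lerD.
  rewrite [A * _]mulrC -mulrA; apply: ler_wpM2l; first exact: powR_ge0.
  have [_ ->] := integrable_Rintegral_sum (dv_intp H).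
  by rewrite mulr_sumr; apply: ler_sum => i _; exact: dv_mom H _ (ltn_ord i).
have := exp_truncated_psum (leqnn n) l0 y0.
rewrite (sum_sqr1 a1) mulr1 => /(ler_wpM2l (expR_ge0 (- (l * x)))) /le_trans; apply.
by rewrite -expRD addrC.
Qed.
End fuk_nagaev.

Section outer_range.
Context {R : realType}.

(** The first two terms come from the tail of the sum, the third from the Gaussian tail, and the
    last makes the bound exceed 1 when |x| < 1. *)
Definition outerC (p A : R) : R :=
  let q := p ^+ 2 + p in
  A * q `^ p * 2 `^ p + expR (4 * q ^+ 2) * 2 `^ q + 2 * expR (2 * q ^+ 2) + 2 `^ q.

Lemma ln_sqr_le (x : R) : 1 <= x -> ln x ^+ 2 <= 4 * x.
Proof.
move=> x1; have x0 : 0 < x by apply: lt_le_trans x1.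
have s0 : 0 < Num.sqrt x by rewrite sqrtr_gt0.
have lnx0 : 0 <= ln x by exact: ln_ge0.
have h : ln (Num.sqrt x) <= Num.sqrt x - 1.
  rewrite -[X in ln X](addrNK 1) addrC le_ln1Dx//.
  by rewrite ltrBrDl subrr.
have -> : 4 * x = (2 * Num.sqrt x) ^+ 2.
  by rewrite exprMn sqr_sqrtr ?ltW//; ring.
rewrite lerXn2r ?nnegrE// ?mulr_ge0 ?sqrtr_ge0//.
rewrite -[X in ln X](sqr_sqrtr (ltW x0)) lnXn//.
rewrite mulr2n; lra.
Qed.

Lemma norm_sub_le3 (u v w1 w2 w3 : R) : 0 <= u -> 0 <= v ->
  u <= w1 -> v <= w2 -> 0 <= w3 -> `|u - v| <= w1 + w2 + w3.
Proof. by move=> *; rewrite ler_norml; apply/andP; split; lra. Qed.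

Lemma norm_sub_unit_le3 (u v w1 w2 w3 : R) : 0 <= u <= 1 -> 0 <= v <= 1 ->
  0 <= w1 -> 0 <= w2 -> 1 <= w3 -> `|u - v| <= w1 + w2 + w3.
Proof.
by move=> /andP[? ?] /andP[? ?] *; rewrite ler_norml; apply/andP; split; lra.
Qed.

Section fixed.
Context {d : measure_display} {T : measurableType d}.
Variables (P : probability T R) (n : nat) (a : nat -> R) (p A : R).
Hypotheses (p2 : 2 < p) (A0 : 0 <= A) (a1 : rem n a 0 = 1).

Let L := \sum_(i < n) `|a i| `^ p.
Let del := L `^ (1 / (1 + p)).

Lemma tail_decay (xi : nat -> T -> R) (x q : R) : q = p ^+ 2 + p ->
  det_var_mds P n xi a p A -> 1 <= x ->
  fine (P [set w | x <= psum xi n w]) <=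
    A * q `^ p * x `^ (- p) * L + expR (4 * q ^+ 2) * x `^ (- q).
Proof.
move=> qE H x1; have p0 : 0 < p by exact: lt_trans p2.
have x0 : 0 < x by apply: lt_le_trans x1.
have q0 : 0 < q by rewrite qE addr_gt0// exprn_gt0.
(* The parameters l = q ln x / x and y = x / q give l y = ln x, so exp(l y) = x and the exponent
   becomes q^2 (ln x)^2 / x - q ln x, at most 4 q^2 - q ln x. *)
have l0 : 0 <= q * ln x / x by rewrite divr_ge0 ?(ltW x0)// mulr_ge0 ?(ltW q0)// ln_ge0.
have y0 : 0 < x / q by rewrite divr_gt0.
apply: (le_trans (tail_bound p2 H x a1 l0 y0)); apply: lerD.
  rewrite -/L; apply: ler_wpM2r; first exact/ltW/weights_gt0.
  rewrite -mulrA; apply: ler_wpM2l => //.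
  rewrite powRM ?(ltW x0) ?invr_ge0 ?(ltW q0)// mulrC.
  by rewrite -(powR_inv1 (ltW q0)) -powRrM mulN1r opprK.
have -> : q * ln x / x * (x / q) = ln x by field; rewrite !gt_eqF.
have -> : q * ln x / x * x = q * ln x by field; rewrite gt_eqF.
rewrite lnK ?posrE// powRN /powR gt_eqF// -expRN -expRD ler_expR.
rewrite lerD2r.
have -> : (q * ln x / x) ^+ 2 * x = q ^+ 2 * (ln x ^+ 2 / x).
  by field; rewrite gt_eqF.
rewrite [leRHS]mulrC; apply: ler_wpM2l; first exact: sqr_ge0.
by rewrite ler_pdivrMr// ln_sqr_le.
Qed.

Lemma del_powR_ge (x : R) : 1 <= del * (1 + `|x|) `^ (p ^+ 2) ->
  (1 + `|x|) `^ (- (p ^+ 2 + p)) <= del * (1 + `|x|) `^ (- p).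
Proof.
move=> h; have X0 : 0 < 1 + `|x| by rewrite ltr_pwDl.
rewrite opprD powRD ?(gt_eqF X0) ?implybT//; apply: ler_wpM2r; first exact: powR_ge0.
by rewrite powRN -[leLHS]mul1r ler_pdivrMr ?powR_gt0.
Qed.

Lemma outer_tail (xi : nat -> T -> R) (x q : R) : q = p ^+ 2 + p ->
  det_var_mds P n xi a p A ->
  1 <= x -> 1 <= del * (1 + `|x|) `^ (p ^+ 2) ->
  fine (P [set w | x <= psum xi n w]) <=
    (A * q `^ p * 2 `^ p + expR (4 * q ^+ 2) * 2 `^ q)
      * (del * (1 + `|x|) `^ (- p)).
Proof.
move=> qE H x1 hx; have p0 : 0 < p by exact: lt_trans p2.
have x0 : 0 < x by apply: lt_le_trans x1.
have q0 : 0 < q by rewrite qE addr_gt0// exprn_gt0.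
have X0 : 0 < 1 + `|x| by rewrite ltr_pwDl.
have dec (r : R) : 0 <= r -> x `^ (- r) <= 2 `^ r * (1 + `|x|) `^ (- r).
  move=> r0; rewrite !powRN ler_pdivlMr ?powR_gt0// mulrC ler_pdivrMr ?powR_gt0//.
  rewrite -powRM ?(ltW x0)// ge0_ler_powR ?nnegrE ?(ltW X0)//.
    by rewrite mulr_ge0 ?(ltW x0).
  by rewrite (gtr0_norm x0); lra.
apply: (le_trans (tail_decay qE H x1)); rewrite [leRHS]mulrDl; apply: lerD.
  rewrite -!mulrA; apply: ler_wpM2l => //; apply: ler_wpM2l; first exact: powR_ge0.
  rewrite [del * _]mulrC mulrA; apply: ler_pM => //.
  - exact: powR_ge0.
  - exact/ltW/weights_gt0.
  - exact/dec/ltW.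
  - exact: weights_le_root.
rewrite -!mulrA; apply: ler_wpM2l; first exact: expR_ge0.
apply: (le_trans (dec q (ltW q0))); apply: ler_wpM2l; first exact: powR_ge0.
by rewrite qE; exact: del_powR_ge.
Qed.

Lemma outer_range (xi : nat -> T -> R) (x : R) : det_var_mds P n xi a p A ->
  1 <= del * (1 + `|x|) `^ (p ^+ 2) ->
  `|fine (P [set t | psum xi n t <= x]) - Phi x| <=
    outerC p A * (del * (1 + `|x|) `^ (- p)).
Proof.
move=> H hx; have p0 : 0 < p by exact: lt_trans p2.
set q := p ^+ 2 + p.
have q0 : 0 < q by rewrite addr_gt0// exprn_gt0.
have X0 : 0 < 1 + `|x| by rewrite ltr_pwDl.
have dq := del_powR_ge hx; rewrite -/q in dq.
set Q := del * _ in dq *.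
have Q0 : 0 <= Q by rewrite mulr_ge0 ?powR_ge0.
set c1 := A * q `^ p * 2 `^ p + expR (4 * q ^+ 2) * 2 `^ q.
set c2 := 2 * expR (2 * q ^+ 2); set c3 : R := 2 `^ q.
have c10 : 0 <= c1 by rewrite addr_ge0// ?mulr_ge0 ?powR_ge0 ?expR_ge0.
have c20 : 0 <= c2 by rewrite mulr_ge0 ?expR_ge0.
have c30 : 0 <= c3 by exact: powR_ge0.
have -> : outerC p A = c1 + c2 + c3 by [].
have mE := measurable_psum_le H x.
have gauss : 2 * expR (- x ^+ 2 / 2) <= c2 * Q.
  rewrite /c2 -[leRHS]mulrA; apply: ler_wpM2l => //.
  apply: (@le_trans _ _ (expR (- x ^+ 2 / 8))).
    by rewrite ler_expR; have := sqr_ge0 x; lra.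
  apply: (le_trans (gauss_decay x (ltW q0))).
  by apply: ler_wpM2l => //; exact: expR_ge0.
have pr0 : 0 <= fine (P [set t | psum xi n t <= x]) by rewrite fine_ge0.
have pr1 : fine (P [set t | psum xi n t <= x]) <= 1.
  by rewrite -lee_fin fineK ?fin_num_measure// probability_le1.
have ph0 := Phi_ge0 x; have ph1 := Phi_le1 x.
have sum3 (u v : R) : 0 <= u -> 0 <= v -> u <= c1 * Q -> v <= c2 * Q ->
    `|u - v| <= (c1 + c2 + c3) * Q.
  by move=> u0 v0 uc vc; rewrite (mulrDl (c1 + c2)) (mulrDl c1); apply: norm_sub_le3 => //; exact: mulr_ge0.
have [x1|x1] := leP 1 x.
  have tl := outer_tail (erefl q) H x1 hx; rewrite -/c1 -/Q in tl.
  have Pc : 1 - fine (P [set t | psum xi n t <= x]) <= fine (P [set t | x <= psum xi n t]).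
    have mE' : measurable [set t | x <= psum xi n t].
      rewrite (_ : mkset _ = psum xi n @^-1` `[x, +oo[); last first.
        by apply/seteqP; split => t /=; rewrite in_itv/= andbT.
      by rewrite -[X in measurable X]setTI; apply: measurable_psum H _ _ _ _.
    rewrite -lee_fin EFinB !fineK ?fin_num_measure// -probability_setC//.
    apply: le_measure; rewrite ?inE//; first exact: measurableC.
    by move=> t /= /negP; rewrite -ltNge => /ltW.
  have := Phi_tail_y (le_trans ler01 x1) => pt.
  have -> : fine (P [set t | psum xi n t <= x]) - Phi x =
    (1 - Phi x) - (1 - fine (P [set t | psum xi n t <= x])) by ring.
  rewrite distrC; apply: sum3; [lra|lra| |].
    exact: le_trans Pc tl.
  exact: le_trans pt gauss.
(* The lower tail is the upper tail of the negated differences, which satisfy the same hypotheses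
   with the same weights. *)
have [x2|x2] := leP x (-1).
  have x1' : 1 <= - x by lra.
  have := outer_tail (erefl q) (det_var_mdsN H) x1'; rewrite normrN => /(_ hx) tl.
  rewrite -/c1 -/Q in tl.
  apply: sum3 => //.
    apply: le_trans tl; rewrite le_eqVlt; apply/orP; left; apply/eqP.
    congr (fine (P _)); apply/seteqP; split => t /=; rewrite /psum sumrN lerN2//.
  have := @Phi_tail_Ny R (- x); rewrite opprK sqrrN => /(_ (le_trans ler01 x1')).
  by move=> /le_trans; apply.
(* For |x| < 1 no tail estimate is needed: 1 + |x| is at most 2, so the claimed bound is at least
   1. *)
have c3Q : 1 <= c3 * Q.
  have Xq : (1 + `|x|) `^ q <= c3.
    rewrite ge0_ler_powR ?nnegrE ?(ltW q0) ?(ltW X0)//.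
    have : `|x| <= 1 by rewrite ler_norml; lra.
    by lra.
  apply: le_trans (ler_wpM2l c30 dq).
  by rewrite powRN ler_pdivlMr ?powR_gt0// mul1r.
rewrite (mulrDl (c1 + c2)) (mulrDl c1).
apply: norm_sub_unit_le3 => //; rewrite ?pr0 ?ph0 ?mulr_ge0//;
  exact: powR_ge0.
Qed.
End fixed.
End outer_range.

Lemma powR_add1_ge {R : realType} (p x : R) : 1 <= p ->
  (1 + `|x|) `^ (- p) <= 1 / (1 + `|x| `^ p).
Proof.
move=> p1; have x0 := normr_ge0 x; set u := `|x| in x0 *.
have u1 : 0 < 1 + u by rewrite ltr_pwDl.
rewrite powRN mul1r lef_pV2 ?posrE ?powR_gt0//; last first.
  by rewrite ltr_pwDl ?powR_ge0.
have p0 : 0 < p by lra.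
rewrite -(mulr_powRB1 (ltW u1) p0) -(mulr_powRB1 x0 p0) mulrDl mul1r.
apply: lerD.
  by rewrite -[leLHS](powRr0 (1 + u)) ler_powR ?lerDl// subr_ge0.
rewrite ler_wpM2l// ge0_ler_powR ?nnegrE ?(ltW u1) ?subr_ge0//.
by rewrite lerDr.
Qed.

Definition nonuniformC {R : realType} (p A : R) : R :=
  (middleD p + (2 * windowK + 1) * middleC p A) + outerC p A.

Section constants.
Context {R : realType}.
Implicit Types p A : R.

Lemma middleD_ge0 p : 0 <= middleD p.
Proof.
apply: mulr_ge0; last exact: expR_ge0.
apply: addr_ge0; last exact: ltW lindC_gt0.
by apply: mulr_ge0 => //; exact: ltW windowK_gt0.
Qed.

Lemma middleC_ge0 p A : 2 < p -> 0 <= A -> 0 <= (2 * windowK + 1) * middleC p A.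
Proof.
move=> p2 A0; apply: mulr_ge0.
  by apply: addr_ge0 => //; apply: mulr_ge0 => //; exact: ltW windowK_gt0.
apply: mulr_ge0; first exact: ltW lindC_gt0.
apply: addr_ge0; last exact: addr_ge0.
apply: mulr_ge0; last by lra.
by apply: mulr_ge0 => //; exact: windowB_ge0.
Qed.

Lemma outerC_ge0 p A : 0 <= A -> 0 <= outerC p A.
Proof. by move=> A0; rewrite /outerC !addr_ge0 ?mulr_ge0 ?powR_ge0 ?expR_ge0. Qed.

Lemma nonuniformC_ge0 p A : 2 < p -> 0 <= A -> 0 <= nonuniformC p A.
Proof.
move=> p2 A0; apply: addr_ge0; last exact: outerC_ge0.
by apply: addr_ge0; [exact: middleD_ge0|exact: middleC_ge0].
Qed.

End constants.

Section nonuniform.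
Context {R : realType} {d : measure_display} {T : measurableType d}.
Variables (P : probability T R) (n : nat) (xi : nat -> T -> R) (a : nat -> R).
Variables (p A : R).

Theorem nonuniform_berry_esseen (x : R) : 2 < p -> 0 <= A ->
  det_var_mds P n xi a p A -> rem n a 0 = 1 ->
  `|fine (P [set t | psum xi n t <= x]) - Phi x| <=
    nonuniformC p A * (\sum_(i < n) `|a i| `^ p) `^ (1 / (1 + p))
      * (1 / (1 + `|x| `^ p)).
Proof.
move=> p2 A0 H a1; have C0 := nonuniformC_ge0 p2 A0.
have p1 : 1 <= p by lra.
rewrite -mulrA; set del := _ `^ (1 / (1 + p)).
have d0 : 0 <= del by exact: powR_ge0.
apply: (@le_trans _ _ (nonuniformC p A * (del * (1 + `|x|) `^ (- p)))); last first.
  apply: ler_wpM2l => //; apply: ler_wpM2l => //; exact: powR_add1_ge.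
have Q0 : 0 <= del * (1 + `|x|) `^ (- p) by rewrite mulr_ge0 ?powR_ge0.
have [w1|w1] := leP (del * (1 + `|x|) `^ (p ^+ 2)) 1.
  apply: (le_trans (middle_range p2 A0 H a1 w1)); apply: ler_wpM2r => //.
  by rewrite lerDl outerC_ge0.
apply: (le_trans (outer_range p2 A0 a1 H (ltW w1))); apply: ler_wpM2r => //.
by rewrite lerDr; apply: addr_ge0; [exact: middleD_ge0|exact: middleC_ge0].
Qed.

End nonuniform.

(** * Conditioning on the regressors *)

Section independent_fubini.
Context {d : measure_display} {T : measurableType d} {R : realType}.
Variables (P : probability T R) (G1 G2 : set (set T)).
Hypotheses (G1m : G1 `<=` d.-measurable) (G2m : G2 `<=` d.-measurable).
Hypothesis indep : forall A B, <<s G1 >> A -> <<s G2 >> B ->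
  (P (A `&` B) = P A * P B)%E.

(** The sample space itself carries the two coarser sigma-algebras. Independence says that the
    diagonal map sends [P] to the product of its restrictions, so Fubini can freeze one copy of the
    sample point without introducing the law of a random vector. *)
Let T1 := g_sigma_algebraType G1.
Let T2 := g_sigma_algebraType G2.
Let to1 (w : T) : T1 := w.
Let to2 (w : T) : T2 := w.

Let mto1 : measurable_fun setT to1.
Proof. by move=> _ B mB; rewrite setTI; exact: (sub_sigma_measurable G1m). Qed.

Let mto2 : measurable_fun setT to2.
Proof. by move=> _ B mB; rewrite setTI; exact: (sub_sigma_measurable G2m). Qed.

Let X1 : {mfun T >-> T1} := HB.pack to1 (isMeasurableFun.Build _ _ _ _ to1 mto1).
Let X2 : {mfun T >-> T2} := HB.pack to2 (isMeasurableFun.Build _ _ _ _ to2 mto2).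
Let P1 : probability T1 R := distribution P X1.
Let P2 : probability T2 R := distribution P X2.
Let diag (w : T) : T1 * T2 := (to1 w, to2 w).

Let mdiag : measurable_fun setT diag.
Proof. exact: measurable_fun_pair. Qed.

Let D : {mfun T >-> (T1 * T2)%type} :=
  HB.pack diag (isMeasurableFun.Build _ _ _ _ diag mdiag).

Lemma measurable_section_prob (E : set (T1 * T2)) : measurable E ->
  measurable_fun setT (fun u : T => P [set w | E (u, w)]).
Proof.
move=> mE; have h := @measurable_fun_xsection _ _ T1 T2 R P2 E mE.
apply: (sub_sigma_measurable_fun G1m).
move: h; rewrite (_ : _ \o _ = fun u : T1 => P [set w | E (u, w)])//.
apply/funext => u /=; rewrite /distribution /pushforward; congr (P _).
by apply/seteqP; split => w /=; rewrite /xsection/= inE.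
Qed.

Lemma indep_fubini (E : set (T1 * T2)) : measurable E ->
  P [set w | E (w, w)] = (\int[P]_u P [set w | E (u, w)])%E.
Proof.
move=> mE.
have PE := @product_measure_unique _ _ T1 T2 R P1 P2 (distribution P D) _ E mE.
have -> : P [set w | E (w, w)] = distribution P D E by [].
rewrite -PE; last first.
  move=> A B mA mB; rewrite /distribution /pushforward -indep//.
rewrite /product_measure1.
have h := @measurable_fun_xsection _ _ T1 T2 R P2 E mE.
rewrite /P1 /distribution ge0_integral_pushforward//; last first.
rewrite preimage_setT; apply: eq_integral => u _ /=.
rewrite /distribution /pushforward; congr (P _).
by apply/seteqP; split => w /=; rewrite /xsection/= inE.
Qed.

End independent_fubini.

(** * The weighted regression noise as martingale differences *)

Section regression.
Context {d : measure_display} {T : measurableType d} {R : realType}.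
Variables (P : probability T R) (n : nat) (eps : nat -> T -> R) (sigma p A : R).
Hypotheses (p2 : 2 < p) (sigma0 : 0 < sigma).
Hypothesis meps : forall k, measurable_fun setT (eps k).
Hypothesis mds : martingale_diff P n eps.
Hypothesis cvar : cond_var_const P n eps sigma.
Hypothesis mom : forall i, (i < n)%N ->
  (\int[P]_w (`|eps i w| `^ p)%:E <= A%:E)%E.

Lemma measurable_norm_powR d' (U : measurableType d') (f : U -> R) (r : R) :
  measurable_fun setT f -> measurable_fun setT (fun w => `|f w| `^ r).
Proof.
move=> mf; apply: (@measurableT_comp _ _ _ _ _ _ (@powR R ^~ r)) => //.
exact: measurableT_comp.
Qed.

Lemma integrable_eps_powR k : (k < n)%N ->
  P.-integrable setT (fun w => (`|eps k w| `^ p)%:E).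
Proof.
move=> kn; apply/integrableP; split.
  exact/measurable_EFinP/measurable_norm_powR.
under eq_integral do rewrite /= ger0_norm ?powR_ge0//.
by apply: le_lt_trans (mom kn) _; exact: ltry.
Qed.

(** The past of the weighted noise may be smaller than that of [eps], for instance when a weight
    vanishes; inclusion is enough, since its test functions are also test functions for [eps]. The
    factor [sigma] normalizes the conditional variances to the squared weights. *)
Lemma det_var_mds_regression (a : nat -> R) :
  det_var_mds P n (fun k w => a k * (eps k w / sigma)) a p (A / sigma `^ p).
Proof.
set xi := fun k w => _.
have s0 : sigma != 0 by rewrite gt_eqF.
have sig0 (k : nat) (B : set R) : measurable B ->
    measurable ((fun t : R => a k * (t / sigma)) @^-1` B).
  move=> mB; rewrite -[X in measurable X]setTI.
  have mf : measurable_fun setT (fun t : R => a k * (t / sigma)).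
    by apply: measurable_funM => //; apply: measurable_funM.
  exact: mf.
have pm k := @past_measurable _ _ _ eps k meps.
have sub k : past xi k `<=` <<s past eps k >>.
  move=> _ [j [B [jk [mB ->]]]]; apply: sub_sigma_algebra.
  exists j, ((fun t : R => a j * (t / sigma)) @^-1` B); split => //; split => //.
  exact: sig0.
have xi_scale k w : xi k w = (a k / sigma) * eps k w by rewrite /xi; ring.
have xi_sqr k w : xi k w ^+ 2 = (a k / sigma) ^+ 2 * eps k w ^+ 2.
  by rewrite xi_scale exprMn.
have xi_powR k w : `|xi k w| `^ p = (`|a k| `^ p / sigma `^ p) * `|eps k w| `^ p.
  rewrite xi_scale normrM powRM// normrM normfV (gtr0_norm sigma0).
  rewrite powRM ?invr_ge0 ?(ltW sigma0)//; congr (_ * _ * _).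
  by rewrite -(powR_inv1 (ltW sigma0)) -powRrM mulN1r powRN.
split.
- by move=> k; apply: measurable_funM => //; apply: measurable_funM.
- move=> k kn; rewrite (_ : EFin \o _ = fun w => (a k / sigma * eps k w)%:E).
    by apply: integrable_scale; have [] := mds kn.
  by apply/funext => w /=; rewrite xi_scale.
- move=> k kn; under eq_fun do rewrite xi_sqr.
  by apply: integrable_scale; have [] := cvar kn.
- move=> k kn; under eq_fun do rewrite xi_powR.
  exact/integrable_scale/integrable_eps_powR.
- move=> k M Y kn mY YM; have [ie e0] := mds kn.
  have mY' := sub_sigma_measurable2 (@sub k) mY.
  have mYT := sub_sigma_measurable_fun (@pm k) mY'.
  transitivity (a k / sigma * \int[P]_w (Y w * eps k w)).
    rewrite -RintegralZl//; last exact: bounded_mul_integrable YM ie.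
    by apply: eq_Rintegral => w _; rewrite xi_scale mulrCA.
  rewrite (@Rintegral_sub_sigma _ _ _ P _ (@pm k) M _ (cst 0) _ ie _ _ mY' YM).
  + rewrite (_ : \int[P]_w (Y w * cst 0 w) = 0) ?mulr0//.
    rewrite -[RHS](Rintegral_cstP P); apply: eq_Rintegral => w _.
    by rewrite /= mulr0.
  + exact: finite_measure_integrable_cst.
  + by move=> B sB; rewrite e0// integral0.
- move=> k M Y kn mY YM; have [ie e0] := cvar kn.
  have mY' := sub_sigma_measurable2 (@sub k) mY.
  have mYT := sub_sigma_measurable_fun (@pm k) mY'.
  have iY : P.-integrable setT (EFin \o Y) by exact: bounded_integrable mYT YM.
  transitivity ((a k / sigma) ^+ 2 * \int[P]_w (Y w * eps k w ^+ 2)).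
    rewrite -RintegralZl//; last exact: bounded_mul_integrable YM ie.
    by apply: eq_Rintegral => w _; rewrite xi_sqr mulrCA.
  rewrite (@Rintegral_sub_sigma _ _ _ P _ (@pm k) M _ (cst (sigma ^+ 2)) _ ie _ _ mY' YM).
  + rewrite RintegralZr//; field.
    exact: s0.
  + exact: finite_measure_integrable_cst.
  + move=> B sB; rewrite e0//.
    have mB : measurable B := sub_sigma_measurable (@pm k) sB.
    by rewrite -(integral_cst P mB (sigma ^+ 2)%:E).
- move=> k kn; under eq_Rintegral do rewrite xi_powR.
  rewrite RintegralZl//; last exact: integrable_eps_powR.
  rewrite [leRHS]mulrC mulrA [leRHS]mulrAC; apply: ler_wpM2l.
    by rewrite divr_ge0 ?powR_ge0.
  rewrite -lee_fin fineK; first exact: mom.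
  exact/integrable_fin_num/integrable_eps_powR.
Qed.

End regression.

(** A substitute for Jensen's inequality: when [s] is the mean of [t], integration gives at most
    twice s^r. Below [s] the power is at most s^r, and above it (t/s)^r <= t/s. *)
Lemma powR_le_affine {R : realType} (r t s : R) : 0 <= r <= 1 -> 0 < s -> 0 <= t ->
  t `^ r <= s `^ r * (1 + t / s).
Proof.
move=> /andP[r0 r1] s0 t0.
have u0 : 0 <= t / s by rewrite divr_ge0 ?(ltW s0).
have s00 : s != 0 by rewrite gt_eqF.
rewrite -[X in X `^ r](divfK s00) mulrC powRM ?(ltW s0)//.
apply: ler_wpM2l; first exact: powR_ge0.
have [u1|u1] := leP (t / s) 1.
  apply: (@le_trans _ _ 1); last by rewrite lerDl.
  by have := powR1 R; move=> /(congr1 (@^~ r)) <-; rewrite ge0_ler_powR ?nnegrE.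
apply: (le_trans (ler1_powR (ltW u1) r1)).
by rewrite lerDr.
Qed.

Lemma probability_setI_full {d} {T : measurableType d} {R : realType}
    (P : probability T R) (E N : set T) : measurable E -> measurable N ->
  P (~` N) = 0%E -> P E = P (E `&` N).
Proof.
move=> mE mN N0; transitivity (P (E `\` N) + P (E `&` N))%E; first exact: measureDI.
rewrite [X in (X + _)%E](_ : _ = 0%E) ?add0e//.
apply/eqP; rewrite eq_le measure_ge0 andbT -N0 le_measure ?inE//.
- exact: measurableD.
- exact: measurableC.
Qed.

Section self_normalized.
Context {d : measure_display} {T : measurableType d} {R : realType}.
Variables (n : nat) (phi : nat -> T -> R).

Definition weight (k : nat) (w : T) : R := phi k w / Num.sqrt (sumsq n phi w).

Lemma sumsq_ge0 w : 0 <= sumsq n phi w.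
Proof. by apply: sumr_ge0 => k _; exact: sqr_ge0. Qed.

Lemma measurable_sumsq d' (U : measurableType d') (f : nat -> U -> R) :
  (forall k, (k < n)%N -> measurable_fun setT (f k)) ->
  measurable_fun setT (fun w => \sum_(k < n) f k w ^+ 2).
Proof.
by move=> mf; apply: measurable_sum => k; apply: measurable_funX; exact: mf.
Qed.

Lemma measurable_powR_sumsq d' (U : measurableType d') (f : nat -> U -> R) (r : R) :
  (forall k, (k < n)%N -> measurable_fun setT (f k)) ->
  measurable_fun setT (fun w => (\sum_(k < n) f k w ^+ 2) `^ r).
Proof.
move=> mf; apply: (@measurableT_comp _ _ _ _ _ _ (@powR R ^~ r)) => //.
exact: measurable_sumsq.
Qed.

Lemma weightE k : weight k = fun w => phi k w * sumsq n phi w `^ (- 2^-1).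
Proof.
apply/funext => w; rewrite /weight powRN powR12_sqrt//.
exact: sumsq_ge0.
Qed.

Lemma sum_sqr_weight w : 0 < sumsq n phi w -> rem n (weight ^~ w) 0 = 1.
Proof.
move=> s0; rewrite /rem big_mkord.
under eq_bigr do rewrite expr_div_n sqr_sqrtr ?(ltW s0)//.
by rewrite -mulr_suml mulfV// gt_eqF.
Qed.

Lemma norm_weight_le1 k w : (k < n)%N -> `|weight k w| <= 1.
Proof.
move=> kn; have := sumsq_ge0 w; rewrite le_eqVlt => /predU1P[s0|s0].
  (* Where the sum of squares vanishes, the weight is 0 because the inverse of 0 is 0. *)
  by rewrite /weight -s0 sqrtr0 invr0 mulr0 normr0.
exact: weight_le1 (sum_sqr_weight s0) _ kn.
Qed.

End self_normalized.

(** * Averaging the conditional bound over the regressors *)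

Section conditioning.
Context {d : measure_display} {T : measurableType d} {R : realType}.
Variables (P : probability T R) (n : nat) (phi eps : nat -> T -> R).
Variables (theta p A sigma : R).
Hypotheses (p2 : 2 < p) (sigma0 : 0 < sigma) (A0 : 0 <= A).
Hypothesis mphi : forall k, measurable_fun setT (phi k).
Hypothesis meps : forall k, measurable_fun setT (eps k).
Hypothesis mds : martingale_diff P n eps.
Hypothesis indep : indep_sigma P (sigma_fam phi n) (sigma_fam eps n).
Hypothesis cvar : cond_var_const P n eps sigma.
Hypothesis mom : forall i, (i < n)%N ->
  (\int[P]_w (`|eps i w| `^ p)%:E <= A%:E)%E.
Hypothesis pos : {ae P, forall w, 0 < sumsq n phi w}.

Let section (x : R) (u : T) : set T :=
  [set w | psum (fun k w => weight n phi k u * (eps k w / sigma)) n w <= x].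
Let L (u : T) : R := \sum_(i < n) `|weight n phi i u| `^ p.

Let mweight k : measurable_fun setT (weight n phi k).
Proof.
rewrite weightE; apply: measurable_funM => //.
exact: measurable_powR_sumsq.
Qed.

Let N := [set w | 0 < sumsq n phi w].

Let mN : measurable N.
Proof.
rewrite (_ : N = sumsq n phi @^-1` `]0, +oo[); last first.
  by apply/seteqP; split => t /=; rewrite in_itv/= andbT.
rewrite -[X in measurable X]setTI.
exact: (measurable_sumsq (fun k _ => mphi k)).
Qed.

Let PN : P (~` N) = 0%E.
Proof.
have [M [mM M0 NM]] := pos; apply/eqP; rewrite eq_le measure_ge0 andbT -M0.
by apply: le_measure; rewrite ?inE//; exact: measurableC.
Qed.

Lemma event_section (x : R) :
  P [set w | (theta_hat n phi (obs theta phi eps) w - theta)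
               * Num.sqrt (sumsq n phi w) <= x * sigma] =
  (\int[P]_u P (section x u))%E /\
  measurable_fun setT (fun u => P (section x u)).
Proof.
pose T1 := g_sigma_algebraType (past phi n).
pose T2 := g_sigma_algebraType (past eps n).
(* The first coordinate carries the regressors and the second the noise; the event of interest is
   the trace of [E] on the diagonal. *)
pose E : set (T1 * T2) := [set z | section x z.1 z.2].
have mw k : (k < n)%N -> measurable_fun setT (weight n phi k : T1 -> R).
  move=> kn; rewrite weightE; apply: measurable_funM; first exact: measurable_past.
  by apply: measurable_powR_sumsq => j jn; exact: measurable_past.
have mE : measurable E.
  pose f (z : T1 * T2) := \sum_(k < n) weight n phi k z.1 * (eps k z.2 / sigma).
  rewrite (_ : E = f @^-1` `]-oo, x]); last first.
    by apply/seteqP; split => t /=; rewrite in_itv.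
  have mf : measurable_fun setT f.
    apply: measurable_sum => k; apply: measurable_funM.
      exact: measurableT_comp (mw k (ltn_ord k)) _.
    apply: measurable_funM => //.
    by apply: (@measurableT_comp _ _ _ _ _ _ (eps k : T2 -> R)) => //; exact: measurable_past.
  by rewrite -[X in measurable X]setTI; exact: mf.
have G1m := @past_measurable _ _ _ phi n mphi.
have G2m := @past_measurable _ _ _ eps n meps.
split; last exact: (measurable_section_prob P G1m G2m mE).
rewrite -(indep_fubini G1m G2m indep mE).
set E1 := mkset _; set E2 := mkset _.
have mE1 : measurable E1.
  pose f w := (theta_hat n phi (obs theta phi eps) w - theta) * Num.sqrt (sumsq n phi w).
  rewrite (_ : E1 = f @^-1` `]-oo, (x * sigma)]); last first.
    by apply/seteqP; split => t /=; rewrite in_itv.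
  have mf : measurable_fun setT f.
    rewrite (_ : f = fun w => ((\sum_(k < n) phi k w * (theta * phi k w + eps k w))
        * sumsq n phi w `^ (-1) - theta) * sumsq n phi w `^ 2^-1); last first.
      by apply/funext => w; rewrite powR_inv1 ?powR12_sqrt ?sumsq_ge0.
    apply: measurable_funM; last exact: (measurable_powR_sumsq _ (fun k _ => mphi k)).
    apply: measurable_funB => //; apply: measurable_funM.
      apply: measurable_sum => k; apply: measurable_funM => //.
      by apply: measurable_funD => //; apply: measurable_funM.
    exact: (measurable_powR_sumsq _ (fun k _ => mphi k)).
  by rewrite -[X in measurable X]setTI; exact: mf.
have mE2 : d.-measurable (E2 : set T).
  rewrite (_ : E2 = psum (fun k w => weight n phi k w * (eps k w / sigma)) n
      @^-1` `]-oo, x]); last first.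
    by apply/seteqP; split => t /=; rewrite in_itv.
  have mf : measurable_fun setT (psum (fun k w => weight n phi k w * (eps k w / sigma)) n).
    apply: measurable_sum => k; apply: measurable_funM => //.
    exact: measurable_funM.
  by rewrite -[X in measurable X]setTI; exact: mf.
(* The normalized estimation error equals [sigma] times the weighted sum only where the sum of
   squares is positive, so both events are first restricted to that set of full probability. *)
rewrite (probability_setI_full mE1 mN PN) (probability_setI_full mE2 mN PN).
suff eE w : 0 < sumsq n phi w -> E1 w = E2 w :> Prop.
  by congr (P _); apply/seteqP; split => w [] /= ew s0; split => //; move: ew;
    rewrite eE.
move=> s0; rewrite /E1 /E2 /E /section /=.
set s := Num.sqrt _; have s1 : 0 < s by rewrite sqrtr_gt0.
have s2 : sumsq n phi w = s ^+ 2 by rewrite sqr_sqrtr ?(ltW s0).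
set Z := \sum_(k < n) phi k w * eps k w.
have numE : \sum_(k < n) phi k w * obs theta phi eps k w = theta * s ^+ 2 + Z.
  rewrite -s2 /sumsq mulr_sumr -big_split/=; apply: eq_bigr => k _.
  by rewrite /obs; ring.
have psumE : psum (fun k w0 => weight n phi k w * (eps k w0 / sigma)) n w = Z / (s * sigma).
  rewrite /psum /Z mulr_suml; apply: eq_bigr => k _.
  by rewrite /weight -/s invfM; ring.
rewrite psumE /theta_hat numE s2.
have -> : ((theta * s ^+ 2 + Z) / s ^+ 2 - theta) * s = Z / (s * sigma) * sigma.
  by field; rewrite !gt_eqF.
by rewrite ler_pM2r.
Qed.

Lemma conditional_bound (x : R) :
  `|fine (P [set w | (theta_hat n phi (obs theta phi eps) w - theta)
                       * Num.sqrt (sumsq n phi w) <= x * sigma]) - Phi x| <=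
  2 * nonuniformC p (A / sigma `^ p)
    * (\sum_(i < n) \int[P]_w (`|weight n phi i w| `^ p)) `^ (1 / (1 + p))
    * (1 / (1 + `|x| `^ p)).
Proof.
have p0 : 0 < p by exact: lt_trans p2.
have [-> mh] := event_section x.
have A'0 : 0 <= A / sigma `^ p by rewrite divr_ge0 ?powR_ge0.
set C := nonuniformC p _; have C0 : 0 <= C by exact: nonuniformC_ge0.
set kap := 1 / (1 + `|x| `^ p); have kap0 : 0 <= kap.
  by rewrite divr_ge0// addr_ge0 ?powR_ge0//.
set al := 1 / (1 + p).
have al01 : 0 <= al <= 1.
  have p10 : 0 < 1 + p by rewrite addr_gt0.
  by rewrite divr_ge0 ?(ltW p10)//= ler_pdivrMr// mul1r lerDl ltW.
have iwt i : (i < n)%N -> P.-integrable setT (EFin \o (fun w => `|weight n phi i w| `^ p)).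
  move=> ni; apply: (@bounded_integrable _ _ _ P 1); first exact: measurable_norm_powR.
  move=> w; rewrite ger0_norm ?powR_ge0//.
  apply: (@le_trans _ _ (1 `^ p)); last by rewrite powR1.
  by rewrite ge0_ler_powR ?nnegrE ?(ltW p0) ?norm_weight_le1.
have [iL eL] := integrable_Rintegral_sum iwt.
rewrite -eL; set t0 := \int[P]_w _.
have L0 u : 0 <= L u by apply: sumr_ge0 => i _; exact: powR_ge0.
(* Positivity allows division by the mean of [L] in the affine bound. Were the mean zero, [L] would
   vanish almost everywhere, whereas weights with squares summing to 1 make it positive: the whole
   space would be null. *)
have t0_gt0 : 0 < t0.
  have t0_ge0 : 0 <= t0 by apply: Rintegral_ge0 => w _; exact: L0.
  rewrite lt_neqAle t0_ge0 andbT; apply/eqP => t00.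
  have mL : measurable_fun setT (EFin \o L) by exact: measurable_int iL.
  have [+ _] := ae_eq_integral_abs P measurableT mL.
  have -> : (\int[P]_w `|(EFin \o L) w| = 0)%E.
    under eq_integral do rewrite /= ger0_norm//.
    have -> : (\int[P]_w (L w)%:E = t0%:E)%E.
      by rewrite /t0 /Rintegral fineK//; exact: integrable_fin_num iL.
    by rewrite -t00.
  move=> /(_ erefl) Lae.
  have [M [mM M0 subM]] : {ae P, forall w : T, False}.
    apply: filterS2 pos Lae => w s0 /(_ I) [Lw].
    have := weights_gt0 p (sum_sqr_weight s0).
    by rewrite -/(L w) Lw ltxx.
  have : (P setT <= P M)%E by apply: le_measure; rewrite ?inE// => w _; exact: subM.
  by rewrite M0 probability_setT lee_fin ler10.
pose h u := fine (P (section x u)).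
have Hu u := det_var_mds_regression sigma0 meps mds cvar mom (weight n phi ^~ u).
have hP u : (h u)%:E = P (section x u).
  by rewrite fineK// fin_num_measure//; exact: measurable_psum_le (Hu u) x.
have mh' : measurable_fun setT h.
  apply/measurable_EFinP; rewrite (_ : EFin \o h = fun u => P (section x u))//.
  by apply/funext => u /=.
have h01 u : 0 <= h u <= 1.
  rewrite -!lee_fin hP measure_ge0/=; apply: probability_le1.
  exact: measurable_psum_le (Hu u) x.
have ih : P.-integrable setT (EFin \o h).
  apply: (@bounded_integrable _ _ _ P 1) => // u.
  by have /andP[? ?] := h01 u; rewrite ger0_norm.
have -> : fine (\int[P]_u P (section x u))%E = \int[P]_u h u.
  by rewrite /Rintegral; under [in RHS]eq_integral do rewrite hP.
pose K := C * t0 `^ al * kap.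
have K0 : 0 <= K by rewrite mulr_ge0// mulr_ge0 ?powR_ge0.
(* The bound for frozen regressors, linearized at the mean [t0] of [L]; on the null set where the
   weights are not normalized, the trivial bound 1 is used instead. *)
pose g u := K * (1 + t0^-1 * L u) + \1_(~` N) u.
have i1 : P.-integrable setT (EFin \o (cst 1 : T -> R)).
  exact: finite_measure_integrable_cst.
have iN : P.-integrable setT (EFin \o (\1_(~` N) : T -> R)).
  by apply: integrable_indic => //; exact: measurableC.
have iKL : P.-integrable setT (fun u => (1 + t0^-1 * L u)%:E).
  by apply: integrable_add => //; exact: integrable_scale.
have ig : P.-integrable setT (EFin \o g).
  by apply: integrable_add => //; exact: integrable_scale.
have ic : P.-integrable setT (EFin \o (cst (Phi x) : T -> R)).
  exact: finite_measure_integrable_cst.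
have -> : \int[P]_u h u - Phi x = \int[P]_u (h u - Phi x).
  by rewrite RintegralB// Rintegral_cstP.
have hg u : `|h u - Phi x| <= g u.
  have g1 : 0 <= K * (1 + t0^-1 * L u).
    by rewrite mulr_ge0// addr_ge0// mulr_ge0// invr_ge0 ltW.
  rewrite /g indicE; have [uN|uN] := boolP (u \in ~` N).
    have /andP[h0 h1] := h01 u; have ph0 := Phi_ge0 x; have ph1 := Phi_le1 x.
    apply: (@le_trans _ _ 1); last by rewrite lerDr.
    by rewrite ler_norml; apply/andP; split; lra.
  have s0 : 0 < sumsq n phi u.
    by apply: contrapT => h0; move/negP: uN; apply; rewrite inE.
  rewrite addr0.
  have := nonuniform_berry_esseen x p2 A'0 (Hu u) (sum_sqr_weight s0).
  move=> /le_trans; apply.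
  rewrite -/C -/kap -/(L u) -/al /K [leRHS]mulrAC; apply: ler_wpM2r => //.
  rewrite -mulrA; apply: ler_wpM2l => //.
  by rewrite [t0^-1 * _]mulrC; exact: powR_le_affine.
have ihc : P.-integrable setT (EFin \o (fun u => h u - Phi x)).
  exact: integrable_sub.
apply: (le_trans (norm_Rintegral_le ihc ig hg)).
rewrite RintegralD//; last exact: integrable_scale.
rewrite RintegralZl// RintegralD//; last exact: integrable_scale.
rewrite Rintegral_cstP RintegralZl// -/t0 mulVf ?gt_eqF//.
have -> : \int[P]_u \1_(~` N) u = 0.
  rewrite /Rintegral integral_indic//; last exact: measurableC.
  rewrite setIT; exact: (congr1 fine PN).
by rewrite addr0 /K le_eqVlt; apply/orP; left; apply/eqP; ring.
Qed.

End conditioning.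

Theorem theorem3p6 (R : realType) (p A sigma : R) :
  2 < p -> 0 < sigma ->
  exists C : R,
  forall (d : measure_display) (T : measurableType d) (P : probability T R)
         (n : nat) (phi eps : nat -> T -> R) (theta : R),
    (forall k, measurable_fun setT (phi k)) ->
    (forall k, measurable_fun setT (eps k)) ->
    mutually_indep P n phi ->
    martingale_diff P n eps ->
    indep_sigma P (sigma_fam phi n) (sigma_fam eps n) ->
    cond_var_const P n eps sigma ->
    (forall i, (i < n)%N ->
       (\int[P]_w (`|eps i w| `^ p)%:E <= A%:E)%E) ->
    {ae P, forall w, 0 < sumsq n phi w} ->
    forall x : R,
      `| fine (P [set w | (theta_hat n phi (obs theta phi eps) w - theta)
                            * Num.sqrt (sumsq n phi w) <= x * sigma])
         - Phi x |
      <= C * (\sum_(i < n) \int[P]_w (`| phi i w / Num.sqrt (sumsq n phi w) | `^ p))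
               `^ (1 / (1 + p))
           * (1 / (1 + `|x| `^ p)).
Proof.
(* The sign of [A] is not assumed, while the estimates require a nonnegative moment constant, hence
   [|A|]. The power of [sigma] comes from normalizing the noise, and the 2 from the affine bound on
   the power. *)
move=> p2 sigma0; exists (2 * nonuniformC p (`|A| / sigma `^ p)).
move=> d T P n phi eps theta mphi meps _ mds indep cvar mom pos x.
apply: conditional_bound => // i ni.
by apply: le_trans (mom i ni) _; rewrite lee_fin ler_norm.
Qed.
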